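(* Consider the generalized $q$-state clock model on the rooted binary tree. For $q=4$ and for $q=5$ there exists a non-empty region $R\subset\mathbb{R}^2$ of values $(\lambda_1,\lambda_2)$ for the eigenvalues $\lambda_1,\lambda_2$ of the transfer matrix $M$ such that, for every $(\lambda_1,\lambda_2)\in R$, there is a transfer matrix $M$ of a generalized $q$-state clock model with these eigenvalues, and the corresponding spin system exhibits a phase transition but no robust phase transition.
   Context: Tree and cutsets. $T=(V,E)$ is the rooted binary tree with root $o$ (every vertex has exactly two children), and $|v|$ is the graph distance from $v$ to $o$. A cutset $C$ is a finite set of vertices such that every self-avoiding infinite path starting from $o$ intersects $C$, and such that there are no $x,y\in C$ with $|x|<|y|$ and $x$ lying on the shortest path from $o$ to $y$. $C^i$ denotes the finite component of $T\setminus C$ (the one containing $o$, when $o\notin C$). Generalized clock model. Let $\Omega_0=\{0,\dots,q-1\}$ with $d(k,l)=1-\cos(2\pi(k-l)/q)$. The transfer matrix $M$ is a $q\times q$ stochastic matrix with strictly positive entries such that $M(k,l)=M(k+g,l+g)$ for all $k,l,g\in\mathbb{Z}_q$, $M(0,j)=M(0,k)$ whenever $d(0,j)=d(0,k)$, and $M$ is non-increasing: $M(i,j)\le M(k,l)$ whenever $d(i,j)\ge d(k,l)$. Its eigenvalues are $\lambda_j=\sum_{k=0}^{q-1}M(0,k)e^{-2\pi i jk/q}$, $j=0,\dots,q-1$; one has $\lambda_0=1$ and $\lambda_j=\lambda_{q-j}$, so for $q=4,5$ the matrix $M$ is determined by $(\lambda_1,\lambda_2)$. The pair potential is $\Phi(i,j)=-\log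 M(i,j)$. Phase transition. For a cutset $C$ and a boundary condition $\delta\in\Omega_0^V$, the finite-volume Gibbs measure on $\Omega_0^{C^i}$ is $$\mu_C^{\Phi,\delta}(\omega)=\frac1Z\exp\Big(-\sum_{\{x,y\}\in E:\,x,y\in C^i}\Phi(\omega_x,\omega_y)-\sum_{\{x,y\}\in E:\,x\in C^i,\,y\in C}\Phi(\omega_x,\delta_y)\Big).$$ A probability measure $\mu$ on $\Omega_0^V$ is a Gibbs measure if for every cutset $C$ its conditional distribution on $C^i$ given the configuration $\delta$ outside $C^i$ is $\mu_C^{\Phi,\delta}$. The model exhibits a phase transition if there is more than one Gibbs measure. Robust phase transition. For $u\in(0,1]$ and a cutset $C$ with $o\notin C$, let $p_{C,o}^{u,\Phi,+}$ be the marginal at the root $o$ of the measure obtained from $\mu_C^{\Phi,\delta}$ by taking $\delta\equiv 0$ and replacing $\Phi$ by $u\Phi$ on all edges connecting $C^i$ to $C$. With $\mathbf 1$ the equidistribution on $\Omega_0$, the model exhibits a robust phase transition if for every $u\in(0,1]$ one has $\inf_C\|p_{C,o}^{u,\Phi,+}-\mathbf 1\|_\infty\neq0$, the infimum being over all cutsets $C$ (with $o\notin C$). *)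

(* Defs.v *)
From HB Require Import structures.
From mathcomp Require Import all_boot all_order all_algebra finmap.
From mathcomp Require Import all_classical all_reals all_analysis.
From mathcomp Require Import complex.

Set Implicit Arguments.
Unset Strict Implicit.
Unset Printing Implicit Defensive.

Import Order.TTheory GRing.Theory Num.Theory.
Import numFieldNormedType.Exports.
Local Open Scope classical_set_scope.
Local Open Scope complex_scope.
Local Open Scope ring_scope.

(** * The rooted binary tree *)

(** A vertex is the word of left/right turns leading to it from the root, so
    that [|v|] is [size v] and the vertices on the shortest path from the root
    to [v] are the prefixes of [v]. *)
Definition vertex := seq bool.

Definition origin : vertex := [::].

Definition child (x y : vertex) : bool :=
  (y == rcons x false) || (y == rcons x true).

Definition adj (x y : vertex) : bool := child x y || child y x.

Definition self_avoiding_ray (p : nat -> vertex) : Prop :=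
  [/\ p 0%N = origin, forall n, adj (p n) (p n.+1) & injective p].

Definition cutset (C : {fset vertex}) : Prop :=
  (forall p, self_avoiding_ray p -> exists n, p n \in C) /\
  ~ (exists x y, [/\ x \in C, y \in C, (size x < size y)%N & prefix x y]).

(** The connected component of the root in the tree deprived of [C]; it is
    empty when the root belongs to [C]. *)
Definition component (C : {fset vertex}) : set vertex :=
  [set v | exists p : seq vertex,
     [/\ path adj origin p, last origin p = v
       & all (fun x => x \notin C) (origin :: p)]].

(** [fset_set] has its default value on infinite sets; see [component_finite]
    below. *)
Definition Ci (C : {fset vertex}) : {fset vertex} := fset_set (component C).

Lemma component_prefix (C : {fset vertex}) (v u : vertex) :
  component C v -> prefix u v -> u \notin C.
Proof.
move=> [p [+ + /allP aC]]; have /= r0 := aC origin (mem_head _ _).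
have {aC} : {in p, forall x, x \notin C}.
  by move=> x xp; apply: aC; rewrite inE xp orbT.
elim/last_ind: p v u => [|p x IH] v u.
  by move=> _ _ <-; rewrite prefixs0 => /eqP ->.
rewrite rcons_path last_rcons => aC /andP[pp axy] <- ux.
have IH' w : prefix w (last origin p) -> w \notin C.
  by apply: IH => // y yp; apply: aC; rewrite mem_rcons inE yp orbT.
have xC : x \notin C by apply: aC; rewrite mem_rcons mem_head.
have [[b E]|[b E]] : (exists b, x = rcons (last origin p) b) \/
    (exists b, last origin p = rcons x b).
- by case/orP: axy => /orP[] /eqP ->; [left|left|right|right]; eexists.
- move: ux; rewrite prefixE E -cats1 take_cat.
  case: ltnP => [_|lu]; first by rewrite -prefixE; exact: IH'.
  case: (size u - size (last origin p))%N => [|k] /= /eqP <-.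
    by rewrite cats0; apply: IH'; exact: prefix_refl.
  by rewrite cats1 -E.
- by apply: IH'; rewrite E; exact: (prefix_trans ux (prefix_rcons _ _)).
Qed.

Lemma component_finite (C : {fset vertex}) : cutset C ->
  finite_set (component C).
Proof.
move=> [hit _]; pose T (y : vertex) := [seq take n y | n <- iota 0 (size y)].
apply: (@sub_finite_set _ _ [set` flatten [seq T y | y <- enum_fset C]]);
  last exact: finite_seq.
move=> v cv; pose p n : vertex := mkseq (nth false v) n.
have [n pnC] : exists n, p n \in C.
  apply: hit; split => // [n|m n /(congr1 size)]; last by rewrite !size_mkseq.
  by rewrite /adj /child /p mkseqS; case: (nth false v n); rewrite eqxx ?orbT.
have takep k : (k <= size v)%N -> p k = take k v.
  move=> kv; apply: (@eq_from_nth _ false) => [|i].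
    by rewrite size_mkseq size_takel.
  by rewrite size_mkseq => ik; rewrite nth_mkseq// nth_take.
have nv : (size v < n)%N.
  rewrite ltnNge; apply/negP => nv.
  have := component_prefix cv (prefix_take v n).
  by rewrite -takep // pnC.
apply/flattenP; exists (T (p n)); first exact: map_f.
apply/mapP; exists (size v); first by rewrite mem_iota add0n size_mkseq.
apply: (@eq_from_nth _ false) => [|i iv].
  by rewrite size_takel // size_mkseq ltnW.
by rewrite nth_take // nth_mkseq //; exact: ltn_trans nv.
Qed.

(** * Transfer matrices of generalized clock models *)

(** For [1 < q] the type ['Z_q] is {0, ..., q-1} with addition modulo [q]. *)
Definition spin_matrix (R : Type) (q : nat) := 'M[R]_((Zp_trunc q).+2).

Section Model.
Variables (R : realType) (q : nat).
Local Notation spin := 'Z_q.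
Implicit Type M : spin_matrix R q.

Definition spin_dist (k l : spin) : R :=
  1 - cos (2 * pi * ((k : nat)%:R - (l : nat)%:R) / q%:R).

Definition stochastic M : Prop :=
  (forall k l : spin, 0 <= M k l) /\
  (forall k : spin, \sum_(l : spin) M k l = 1).

Definition clock_transfer_matrix M : Prop :=
  [/\ stochastic M,
      forall k l : spin, 0 < M k l,
      forall k l g : spin, M k l = M (k + g) (l + g),
      forall j k : spin, spin_dist 0 j = spin_dist 0 k -> M 0 j = M 0 k
    & forall i j k l : spin, spin_dist i j >= spin_dist k l -> M i j <= M k l].

(** The exponential of [- i * t]. *)
Definition expNi (t : R) : R[i] := cos t -i* sin t.

(** The [j]-th eigenvalue, i.e. the one of the character
    [k |-> exp (2 * pi * i * j * k / q)]. *)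
Definition transfer_eigenvalue M (j : nat) : R[i] :=
  \sum_(k : spin) (M 0 k)%:C * expNi (2 * pi * j%:R * (k : nat)%:R / q%:R).

Definition pair_potential M (i j : spin) : R := - ln (M i j).

(** * Finite-volume Gibbs measures *)

Definition config := vertex -> spin.

HB.instance Definition _ := Choice.copy config (vertex -> spin).
HB.instance Definition _ := isPointed.Build config (fun=> 0).

Definition fin_config (C : {fset vertex}) := {ffun Ci C -> spin}.

(** [Phi] acts on the inner edges, each of which is counted once, from parent
    to child, and [Psi] on the edges between [Ci C] and [C]. *)
Definition boltzmann_weight (Phi Psi : spin -> spin -> R) (C : {fset vertex})
    (delta : config) (w : fin_config C) : R :=
  expR (- (\sum_(x : Ci C) \sum_(y : Ci C | child (val x) (val y))
             Phi (w x) (w y))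
        - \sum_(x : Ci C) \sum_(y : C | adj (val x) (val y))
             Psi (w x) (delta (val y))).

Definition fin_gibbs (Phi Psi : spin -> spin -> R) (C : {fset vertex})
    (delta : config) (w : fin_config C) : R :=
  boltzmann_weight Phi Psi delta w /
  \sum_(w' : fin_config C) boltzmann_weight Phi Psi delta w'.

(** * Infinite-volume Gibbs measures and phase transition *)

Definition cylinders (A : set vertex) : set (set config) :=
  [set B | exists v a, A v /\ B = [set w | w v = a]].

(** Configurations with the product sigma-algebra. *)
Definition config_space := g_sigma_algebraType (cylinders setT).

HB.instance Definition _ := Measurable.on config_space.

Definition extends (C : {fset vertex}) (w : fin_config C) : set config_space :=
  [set s | forall x : Ci C, s (val x) = w x].

(** The conditional distribution is characterized by integration over the
    events [B] of the sigma-algebra generated by the spins outside [Ci C]. *)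
Definition is_gibbs (Phi : spin -> spin -> R)
    (mu : probability config_space R) : Prop :=
  forall C, cutset C -> forall (w : fin_config C) (B : set config_space),
    <<s cylinders (~` [set` Ci C]) >> B ->
    mu (extends w `&` B) =
      (\int[mu]_(delta in B) (fin_gibbs Phi Phi delta w)%:E)%E.

Definition phase_transition (Phi : spin -> spin -> R) : Prop :=
  exists mu nu : probability config_space R,
    [/\ is_gibbs Phi mu, is_gibbs Phi nu
      & exists2 A : set config_space, measurable A & mu A <> nu A].

(** * Robust phase transition *)

(** Meaningful when the root is not in [C], i.e. when it belongs to [Ci C]. *)
Definition root_marginal (u : R) (Phi : spin -> spin -> R)
    (C : {fset vertex}) (a : spin) : R :=
  \sum_(w : fin_config C | [exists x : Ci C, (val x == origin) && (w x == a)])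
     fin_gibbs Phi (fun i j => u * Phi i j) (fun=> 0) w.

Definition dist_to_uniform (p : spin -> R) : R :=
  \big[Num.max/0]_(a : spin) `|p a - q%:R^-1|.

Definition robust_phase_transition (Phi : spin -> spin -> R) : Prop :=
  forall u : R, 0 < u <= 1 ->
    inf [set dist_to_uniform (root_marginal u Phi C)
        | C in [set C | cutset C /\ origin \notin C]] != 0.

End Model.

(* Main.v *)
(** A positive function [f] on the spins with [(M f)^2 = kap f] is the law of
    the root in a completely homogeneous Gibbs measure: the tree-indexed Markov
    chain with transition probabilities [M i j f j / (M f) i].  The constant
    [f = 1] always is such a function, so a non-constant one gives a phase
    transition.  Writing [f = g^2] with [g = 1 + x c1 + y c2] in the even
    characters [c1, c2] of [Z_q], the equation reads [g] proportional to
    [M (g^2)], two polynomial equations in [(x, y)] which are solved by the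
    intermediate value theorem for [(l1, l2)] close to [(0.49, 0.45)].

    On the other hand, the root marginal with boundary condition at level [n]
    is obtained by iterating [g |-> M (g^2)]; the derivative of this map at the
    constants has eigenvalues [2 l1] and [2 l2], both smaller than [1].  A small
    [u] makes the boundary message close to a constant, hence the marginals at
    the root converge to the uniform distribution. *)

(* The two conclusions are compatible because the bifurcation from the constants at [2 * l1 = 1] is
   subcritical for these [l2]. For small [x] and [l1] near [1/2], the second equation forces [y] to
   be of order [x^2], and the feedback of [y] into the first equation beats the growth of the
   normalisation [kap] as soon as [l2 > 1/3] for [q = 4] and [l2 > 2/5] for [q = 5]. Non-constant
   solutions then survive for [l1] slightly below [1/2], where the constants still attract. Hence
   the choice of [l2] near [9/20], beyond both thresholds, with [l1] just below [1/2]. Refuting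
   robustness takes a single [u] and a sequence of cutsets. Levels suffice, and on them all messages
   at the same depth coincide, so a single function is iterated. *)
Require Import Defs.
From HB Require Import structures.
From mathcomp Require Import all_boot all_order all_algebra finmap.
From mathcomp Require Import all_classical all_reals all_analysis.
From mathcomp Require Import complex.
From mathcomp Require Import measurable_realfun zify ring lra.

Import Order.TTheory GRing.Theory Num.Theory.
Import numFieldNormedType.Exports.
Local Open Scope classical_set_scope.
Local Open Scope complex_scope.
Local Open Scope ring_scope.

(** * Random sequences with prescribed finite-dimensional laws *)

Section RandomSequence.
Variables (R : realType) (d : nat) (p : seq 'I_d.+1 -> R).
Local Notation A := 'I_d.+1.
Hypothesis p_ge0 : forall w, 0 <= p w.
Hypothesis p_nil : p [::] = 1.
Hypothesis p_rcons : forall w, p w = \sum_a p (rcons w a).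

Let offset (w : seq A) (n : nat) : R := \sum_(b : A | (b < n)%N) p (rcons w b).

(* The unit interval is cut into one cell per word of length [n], of length
   [p w] and refining the cells of length [n - 1]; the sequence read at a point
   of the interval then has the law [p].  The left end point is computed on the
   reversed word. *)
Fixpoint rev_lower (v : seq A) : R :=
  if v is a :: v' then rev_lower v' + offset (rev v') a else 0.

Definition lower (w : seq A) : R := rev_lower (rev w).

Definition cell (w : seq A) : set R := [set x | lower w <= x < lower w + p w].

Let lower_rcons w a : lower (rcons w a) = lower w + offset w a.
Proof. by rewrite /lower rev_rcons /= revK. Qed.

Let offsetS w (a : A) : offset w a.+1 = offset w a + p (rcons w a).
Proof.
rewrite /offset (bigD1 a) //= addrC; congr (_ + _).
by apply: eq_bigl => b; rewrite ltnS ltn_neqAle andbC.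
Qed.

Let le_offset w (m n : nat) : (m <= n)%N -> offset w m <= offset w n.
Proof.
move=> mn; rewrite /offset [leRHS](bigID (fun b : A => (b < m)%N)) /=.
rewrite [X in _ <= X + _](eq_bigl (fun b : A => (b < m)%N)) => [|b].
  by rewrite lerDl sumr_ge0.
by rewrite andbC; case: ltnP => //= /leq_trans -> //.
Qed.

Let offset_full w : offset w d.+1 = p w.
Proof. by rewrite p_rcons; apply: eq_bigl => b; rewrite ltn_ord. Qed.

Lemma cell_rcons w a : cell (rcons w a) `<=` cell w.
Proof.
move=> x; rewrite /cell /= lower_rcons -addrA -offsetS => /andP[h1 h2].
have o0 : 0 <= offset w a by rewrite sumr_ge0.
apply/andP; split; first by apply: le_trans h1; rewrite lerDl.
by apply: (lt_le_trans h2); rewrite lerD2l -offset_full le_offset.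
Qed.

Lemma cell_cover w x : cell w x -> exists a, cell (rcons w a) x.
Proof.
rewrite /cell /= => /andP[h1 h2].
(* The first division point to the right of [x] ends the wanted cell. It is not the point of index
   [0], the left end of [cell w]. *)
have ex : exists n, x < lower w + offset w n by exists d.+1; rewrite offset_full.
case: (ex_minnP ex) => -[|n] xn nmin.
  by move: xn; rewrite /offset big_pred0 // addr0 ltNge h1.
have nd : (n < d.+1)%N by rewrite nmin // offset_full.
exists (Ordinal nd); rewrite /= lower_rcons -addrA -offsetS xn andbT leNgt.
by apply/negP => /nmin; rewrite ltnn.
Qed.

Lemma cell_rcons_inj w a b x : cell (rcons w a) x -> cell (rcons w b) x -> a = b.
Proof.
wlog ab : a b / (a <= b)%N => [hw|].
  by case/orP: (leq_total a b) => ab ha hb; [|symmetry]; apply: hw.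
rewrite /cell /= !lower_rcons -!addrA -!offsetS => /andP[_ h1] /andP[h2 _].
apply/val_inj/eqP; move: ab; rewrite leq_eqVlt => /orP[//|ab].
have := le_lt_trans h2 h1; rewrite ltrD2l ltNge.
by rewrite le_offset.
Qed.

Lemma cell_inj w w' x : size w = size w' -> cell w x -> cell w' x -> w = w'.
Proof.
elim/last_ind: w w' => [|w a IH] w'; first by case: w'.
case/lastP: w' => [|w' b]; first by rewrite size_rcons.
rewrite !size_rcons => -[sw] ha hb.
have E := IH _ sw (cell_rcons _ _ _ ha) (cell_rcons _ _ _ hb).
by move: hb; rewrite -E => hb; rewrite (cell_rcons_inj _ _ _ _ ha hb).
Qed.

(** For [x] in the unit interval a child cell containing [x] always exists, so the default [ord0] is
    taken only outside that interval. *)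
Fixpoint walk (x : R) (n : nat) : seq A :=
  if n is m.+1 then
    rcons (walk x m) (odflt ord0 [pick a | `[< cell (rcons (walk x m) a) x >]])
  else [::].

Lemma size_walk x n : size (walk x n) = n.
Proof. by elim: n => //= n IH; rewrite size_rcons IH. Qed.

Lemma cell_walk x n : 0 <= x < 1 -> cell (walk x n) x.
Proof.
move=> x01; elim: n => [|n IH]; first by rewrite /cell /= p_nil /lower /= add0r.
rewrite [walk _ _]/=; case: pickP => [a /asboolP //|h].
by have [a ha] := cell_cover _ _ IH; have /asboolP := h a.
Qed.

Lemma take_walk x m n : (m <= n)%N -> take m (walk x n) = walk x m.
Proof.
elim: n => [|n IH]; first by rewrite leqn0 => /eqP ->.
rewrite leq_eqVlt => /orP[/eqP ->|]; first by rewrite take_oversize // size_walk.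
by rewrite ltnS => mn; rewrite [walk _ n.+1]/= -cats1 takel_cat ?size_walk // IH.
Qed.

Definition coordinate (k : nat) (x : R) : A :=
  if 0 <= x < 1 then nth ord0 (walk x k.+1) k else ord0.

(** Both sides say that [w] is the walk of [x] of the same length. *)
Lemma coordinate_cell w x : 0 <= x < 1 ->
  (forall k, (k < size w)%N -> coordinate k x = nth ord0 w k) <-> cell w x.
Proof.
move=> x01; have ww := cell_walk x (size w) x01; split => [h|h].
  suff -> : w = walk x (size w) by [].
  apply: (@eq_from_nth _ ord0) => [|k kw]; first by rewrite size_walk.
  by rewrite -h // /coordinate x01 -(take_walk x k.+1 (size w)) // nth_take.
move=> k kw; rewrite /coordinate x01 -(take_walk x k.+1 (size w)) // nth_take //.
by congr nth; apply: cell_inj ww h; rewrite size_walk.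
Qed.

Let I01 : set (measurableTypeR R) := [set x | 0 <= x < 1].

Let mitv (a b : R) : measurable ([set x | a <= x < b] : set (measurableTypeR R)).
Proof.
rewrite (_ : [set _ | _] = [set` `[a, b[]); first exact: measurable_itv.
by apply/seteqP; split => x /=; rewrite in_itv.
Qed.

Lemma measurable_coordinate k (a : A) :
  measurable ([set x | coordinate k x = a] : set (measurableTypeR R)).
Proof.
pose D : set (k.+1.-tuple A) := [set w | nth ord0 w k = a].
rewrite (_ : [set x | _] = (\bigcup_(w in D) (cell w `&` I01)) `|`
    (~` I01 `&` [set x | ord0 = a])).
  apply: measurableU.
    by apply: fin_bigcup_measurable => // w _; apply: measurableI; exact: mitv.
  apply: measurableI; first by apply: measurableC; exact: mitv.
  have [E|E] := pselect (ord0 = a).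
    by rewrite (_ : [set x | _] = setT) //; apply/seteqP; split.
  by rewrite (_ : [set x | _] = set0) //; apply/seteqP; split.
apply/seteqP; split => x /=.
  have [x01 h|x01] := boolP (0 <= x < 1); last first.
    rewrite /coordinate (negbTE x01) => <-; right; split => //.
    exact/negP.
  left; have sw : size (walk x k.+1) == k.+1 by rewrite size_walk.
  exists (Tuple sw); last by split => //; exact: cell_walk.
  by move: h; rewrite /D /coordinate x01.
case=> [[w wD [wx x01]]|[/negP x01 <-]].
  have /(_ k) := (coordinate_cell w x x01).2 wx; rewrite size_tuple => -> //.
by rewrite /coordinate (negbTE x01).
Qed.

Definition unit_lebesgue : set (measurableTypeR R) -> \bar R :=
  mrestr (@lebesgue_measure R) (mitv 0 1).

HB.instance Definition _ := Measure.on unit_lebesgue.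

Let unit_lebesgueT : unit_lebesgue setT = 1%E.
Proof.
rewrite /unit_lebesgue /mrestr setTI.
rewrite (_ : [set _ | _] = [set` `[0:R, 1[]).
  by rewrite lebesgue_measure_itv /= lte_fin ltr01 oppr0 adde0.
by apply/seteqP; split => x /=; rewrite in_itv.
Qed.

HB.instance Definition _ := Measure_isProbability.Build _ _ _
  unit_lebesgue unit_lebesgueT.

Lemma unit_lebesgue_coordinates w :
  unit_lebesgue [set x | forall k, (k < size w)%N -> coordinate k x = nth ord0 w k]
  = (p w)%:E.
Proof.
rewrite /unit_lebesgue /mrestr (_ : _ `&` _ = [set` `[lower w, lower w + p w[]).
  rewrite lebesgue_measure_itv /= lte_fin ltrDl lt_neqAle p_ge0 andbT eq_sym.
  case: eqP => [->//|_] /=.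
  by rewrite -EFinD addrAC subrr add0r.
apply/seteqP; split => x /=; rewrite in_itv /=.
  by move=> [h x01]; exact: (coordinate_cell w x x01).1.
move=> wx.
have x01 : 0 <= x < 1.
  elim/last_ind: w wx => [|w a IH wx]; last exact/IH/(cell_rcons w a).
  by rewrite /lower /= p_nil add0r.
by split => //; exact: (coordinate_cell w x x01).2.
Qed.

End RandomSequence.

(* Breadth-first numbering: the children of the vertex [k] are [2k+1], [2k+2]. *)
Definition heap_index (v : vertex) : nat :=
  foldl (fun n (b : bool) => (n.*2 + b).+1) 0%N v.

Lemma heap_index_rcons v b : heap_index (rcons v b) = ((heap_index v).*2 + b).+1.
Proof. by rewrite /heap_index -cats1 foldl_cat. Qed.

Lemma heap_index_inj : injective heap_index.
Proof.
move=> v; elim/last_ind: v => [|v b IH] v'; case/lastP: v' => [|v' b'] //;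
  rewrite ?heap_index_rcons // => -[E].
have [Ev Eb] : heap_index v = heap_index v' /\ b = b'.
  by split; move: E; case: b; case: b' => /=; lia.
by rewrite Eb (IH _ Ev).
Qed.

(** The parent of [m + 1] is [m / 2] and the parity of [m] is the last turn. Halving is not a
    structural recursion, hence the fuel. *)
Fixpoint heap_vertex_rec (fuel n : nat) : vertex :=
  if fuel is f.+1 then
    if n is m.+1 then rcons (heap_vertex_rec f m./2) (odd m) else [::]
  else [::].

Definition heap_vertex (n : nat) : vertex := heap_vertex_rec n n.

Lemma heap_vertexK : cancel heap_vertex heap_index.
Proof.
move=> n; rewrite /heap_vertex.
suff H f m : (m <= f)%N -> heap_index (heap_vertex_rec f m) = m by exact: H.
elim: f m => [|f IH] [|m] //= mf.
by rewrite heap_index_rcons IH; [rewrite addnC odd_double_half|lia].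
Qed.

Lemma heap_indexK : cancel heap_index heap_vertex.
Proof. by move=> v; apply: heap_index_inj; rewrite heap_vertexK. Qed.

Section RandomConfig.
Variables (R : realType) (q : nat) (p : seq 'Z_q -> R).
Hypothesis p_ge0 : forall w, 0 <= p w.
Hypothesis p_nil : p [::] = 1.
Hypothesis p_rcons : forall w, p w = \sum_a p (rcons w a).

(** The image of Lebesgue measure under the coordinates, read along the heap numbering, takes the
    place of an extension theorem. *)
Lemma config_measure_exists : exists mu : probability (config_space q) R,
  forall w : seq 'Z_q,
    mu [set s | forall k, (k < size w)%N -> s (heap_vertex k) = nth 0 w k]
    = (p w)%:E.
Proof.
pose X (x : measurableTypeR R) : config_space q :=
  fun v => coordinate R _ p (heap_index v) x.
have mX : measurable_fun setT X.
  apply: (@measurability _ _ _ (config_space q) setT X (@cylinders q setT)) => //.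
  move=> _ [_ [v [a [_ ->]]] <-].
  rewrite setTI.
  exact: (measurable_coordinate R _ p p_ge0 p_nil p_rcons (heap_index v) a).
exists (distribution (unit_lebesgue R) (mfun_Sub (mem_set mX))) => w.
rewrite -(unit_lebesgue_coordinates R _ p p_ge0 p_nil p_rcons w).
rewrite /distribution /pushforward /=; congr (_ _); apply/seteqP; split => x /= h k kw.
  by rewrite -h // /X heap_vertexK.
by rewrite /X heap_vertexK h.
Qed.

End RandomConfig.

(** * Cutsets and Boltzmann weights *)

Lemma in_Ci (C : {fset vertex}) x : cutset C -> (x \in Ci C) = (x \in component C).
Proof. by move=> cC; rewrite in_fset_set //; exact: component_finite. Qed.

Lemma Ci_notin (C : {fset vertex}) x : cutset C -> x \in Ci C -> x \notin C.
Proof.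
by move=> cC; rewrite in_Ci // inE => /component_prefix; apply; exact: prefix_refl.
Qed.

Lemma Ci_adj (C : {fset vertex}) x y :
  cutset C -> x \in Ci C -> adj x y -> y \notin C -> y \in Ci C.
Proof.
move=> cC; rewrite !in_Ci // !inE => -[p [pp lp ap]] xy yC.
exists (rcons p y); rewrite rcons_path last_rcons pp lp xy; split => //.
by rewrite -rcons_cons all_rcons yC ap.
Qed.

Lemma Ci_parent (C : {fset vertex}) x b :
  cutset C -> rcons x b \in Ci C -> x \in Ci C.
Proof.
move=> cC xb; apply: (Ci_adj C (rcons x b)) => //.
  by rewrite /adj /child; case: b {xb}; rewrite eqxx ?orbT.
move: xb; rewrite in_Ci // inE => /component_prefix; apply; exact: prefix_rcons.
Qed.

Lemma Ci_child (C : {fset vertex}) x b : cutset C -> x \in Ci C ->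
  (rcons x b \in C) = (rcons x b \notin Ci C).
Proof.
move=> cC xC; apply/idP/idP => [|h]; first by apply: contraL; exact: Ci_notin.
apply: contraNT h; apply: Ci_adj xC _ => //.
by rewrite /adj /child; case: b; rewrite eqxx ?orbT.
Qed.

(** Edges from the component to the cutset lead away from the root: a parent in [C] would be a
    prefix of [x] and cut it off. *)
Lemma Ci_adj_child (C : {fset vertex}) x y : cutset C -> x \in Ci C -> y \in C ->
  adj x y = child x y.
Proof.
move=> cC xC yC; rewrite /adj; case xy: (child x y) => //=; apply/negP => yx.
move: xC; rewrite in_Ci // inE => /component_prefix /(_ _) xC.
suff /xC : prefix y x by rewrite yC.
by move/orP: yx => [] /eqP ->; exact: prefix_rcons.
Qed.

Lemma sum_children (V : nmodType) (S : {fset vertex}) x (F : vertex -> V) :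
  \sum_(y : S | child x (val y)) F (val y) =
  \sum_(b : bool | rcons x b \in S) F (rcons x b).
Proof.
transitivity (\sum_(y : S) \sum_(b | val y == rcons x b) F (rcons x b)).
  rewrite big_mkcond; apply: eq_bigr => y _; rewrite big_mkcond big_bool /= /child.
  have := @rcons_injr _ x; case: eqVneq => [->|_] inj; last first.
    by case: eqVneq => [->|_] /=; rewrite ?add0r ?addr0.
  by case: eqVneq => [/inj //|_] /=; rewrite add0r.
rewrite (exchange_big_dep xpredT) //= [RHS]big_mkcond; apply: eq_bigr => b _.
case: ifPn => bS; first by rewrite (big_pred1 [` bS]%fset).
by rewrite big_pred0 // => y; apply: contraNF bS => /eqP <-; exact: valP.
Qed.

Section Override.
Variables (R : realType) (q : nat) (C : {fset vertex}).
Hypothesis cC : cutset C.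

Definition override (w : fin_config q C) (s : config q) : config q :=
  fun v => if insub v is Some x then w x else s v.

Lemma override_in (w : fin_config q C) s (x : Ci C) : override w s (val x) = w x.
Proof. by rewrite /override valK. Qed.

Lemma override_out (w : fin_config q C) s v : v \notin Ci C -> override w s v = s v.
Proof. by move=> vC; rewrite /override insubN. Qed.

(** A single product over vertices and turns replaces the two sums over edges. This form can be
    matched both with the chain and with the recursion along branches. *)
Lemma boltzmann_weightE (Phi Psi : 'Z_q -> 'Z_q -> R) s w :
  boltzmann_weight Phi Psi s w = \prod_(x <- Ci C) \prod_(b : bool)
    expR (- (if rcons x b \in Ci C then Phi else Psi)
            (override w s x) (override w s (rcons x b))).
Proof.
rewrite big_seq_fsetE /=.
under [RHS]eq_bigr do rewrite -expR_sum.
rewrite -expR_sum /boltzmann_weight; congr expR.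
rewrite -opprD -big_split -sumrN /=; apply: eq_bigr => x _.
rewrite sumrN; congr (- _).
under eq_bigr do rewrite -!(override_in w s).
rewrite (sum_children _ _ _ (fun y => Phi (override w s (val x)) (override w s y))).
rewrite [X in _ + X](_ : _ = \sum_(y : C | child (val x) (val y))
    Psi (override w s (val x)) (override w s (val y))); last first.
  apply: eq_big => y; first by rewrite (Ci_adj_child C) ?(valP x) ?(valP y).
  move=> _; rewrite [in RHS]override_in override_out //.
  by apply: contraL (valP y); exact: Ci_notin.
rewrite (sum_children _ _ _ (fun y => Psi (override w s (val x)) (override w s y))).
rewrite big_mkcond [X in _ + X]big_mkcond -big_split; apply: eq_bigr => b _ /=.
rewrite (Ci_child C) ?(valP x) //.
by case: ifP; rewrite ?addr0 ?add0r.
Qed.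

End Override.

(** * Tree-indexed Markov chains and their Gibbs property *)

Lemma heap_vertex_child k (b : bool) :
  heap_vertex (k.*2 + b).+1 = rcons (heap_vertex k) b.
Proof.
by apply: heap_index_inj; rewrite heap_vertexK heap_index_rcons heap_vertexK.
Qed.

Lemma prod_fset_heap (R : comPzSemiRingType) (S : {fset vertex}) (N : nat)
    (F : vertex -> R) : (forall x, x \in S -> (heap_index x < N)%N) ->
  \prod_(x <- S) F x =
  \prod_(0 <= k < N | heap_vertex k \in S) F (heap_vertex k).
Proof.
move=> SN; rewrite -[RHS]big_filter -(big_map heap_vertex xpredT F).
apply: perm_big; apply: uniq_perm; first exact: fset_uniq.
  rewrite map_inj_uniq; last exact: can_inj heap_vertexK.
  by rewrite filter_uniq // iota_uniq.
move=> x; apply/idP/mapP => [xS|[k]].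
  exists (heap_index x); last by rewrite heap_indexK.
  by rewrite mem_filter heap_indexK xS mem_index_iota SN.
by rewrite mem_filter => /andP[+ _] ->.
Qed.

Section Chain.
Variables (R : realType) (q : nat) (M : spin_matrix R q) (f : 'Z_q -> R) (kap : R).
Hypothesis M_gt0 : forall i j, 0 < M i j.
Hypothesis f_gt0 : forall i, 0 < f i.
Hypothesis fE : forall i, (\sum_j M i j * f j) ^+ 2 = kap * f i.

Let Mf i := \sum_j M i j * f j.
Let Z := \sum_i f i.

Let sum_gt0 (F : 'Z_q -> R) : (forall i, 0 < F i) -> 0 < \sum_i F i.
Proof.
move=> F0; rewrite (bigD1 0) //= ltr_pwDl // sumr_ge0 // => i _; exact: ltW.
Qed.

Let Mf_gt0 i : 0 < Mf i.
Proof. by apply: sum_gt0 => j; rewrite mulr_gt0. Qed.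

Let Z_gt0 : 0 < Z. Proof. exact: sum_gt0. Qed.

Let kap_gt0 : 0 < kap.
Proof.
by rewrite -(pmulr_lgt0 _ (f_gt0 0)) -fE exprn_gt0 // Mf_gt0.
Qed.

(* In the breadth-first numbering, the parent of the vertex [l + 1] is [l / 2]. *)
Definition chain_factor (s : nat -> 'Z_q) (k : nat) : R :=
  if k is l.+1 then M (s l./2) (s k) * f (s k) / Mf (s l./2) else f (s 0%N) / Z.

Definition chain (w : seq 'Z_q) : R :=
  \prod_(0 <= k < size w) chain_factor (nth 0 w) k.

Let chain_factor_gt0 s k : 0 < chain_factor s k.
Proof. by case: k => [|k] /=; rewrite !(mulr_gt0, invr_gt0). Qed.

Lemma chain_ge0 w : 0 <= chain w.
Proof. by apply: prodr_ge0 => k _; exact: ltW. Qed.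

Lemma chain_nil : chain [::] = 1.
Proof. by rewrite /chain big_geq. Qed.

Let eq_chain_factor s s' k : (forall l, (l <= k)%N -> s l = s' l) ->
  chain_factor s k = chain_factor s' k.
Proof. by case: k => [|k] ss' /=; rewrite !ss' //; lia. Qed.

Lemma chain_rcons w : chain w = \sum_a chain (rcons w a).
Proof.
transitivity (\sum_a chain w * chain_factor (nth 0 (rcons w a)) (size w)).
  rewrite -mulr_sumr -[LHS]mulr1; congr (_ * _).
  case sw: (size w) => [|k] /=.
    rewrite -mulr_suml /= (eq_bigr f) ?divff ?gt_eqF // => i _.
    by rewrite nth_rcons sw.
  rewrite (eq_bigr (fun a => M (nth 0 w k./2) a * f a / Mf (nth 0 w k./2))).
    by rewrite -mulr_suml divff // gt_eqF //; exact: Mf_gt0.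
  move=> a _; rewrite !nth_rcons sw ltnn eqxx.
  by rewrite ifT //; lia.
apply: eq_bigr => a _; rewrite /chain size_rcons big_nat_recr //=; congr (_ * _).
apply: eq_big_nat => k /andP[_ kw]; apply: eq_chain_factor => l lk.
by rewrite nth_rcons (leq_ltn_trans lk kw).
Qed.

Lemma chain_mkseq s n : chain (mkseq s n) = \prod_(0 <= k < n) chain_factor s k.
Proof.
rewrite /chain size_mkseq; apply: eq_big_nat => k /andP[_ kn].
by apply: eq_chain_factor => l lk; rewrite nth_mkseq // (leq_ltn_trans lk kn).
Qed.

(* Since [(M f)^2 = kap f], revealing both children of a vertex replaces its
   factor [f] by those of the children: the Markov chain has the form of a Gibbs
   distribution, with weights [f] on the leaves. *)
Lemma chain_heap (s : nat -> 'Z_q) N : chain (mkseq s N.*2.+1) * (Z * kap ^+ N) =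
  (\prod_(0 <= k < N) \prod_(b : bool) M (s k) (s (k.*2 + b).+1)) *
  \prod_(N <= k < N.*2.+1) f (s k).
Proof.
rewrite chain_mkseq; elim: N => [|N IH].
  rewrite big_nat1 big_geq // big_nat1 mul1r expr0 mulr1 /=.
  by rewrite mulfVK // gt_eqF.
have Nm : (N < N.*2.+1)%N by lia.
rewrite doubleS; rewrite (big_ltn Nm) in IH.
rewrite (@big_nat_recr _ _ _ N.*2.+2) // (@big_nat_recr _ _ _ N.*2.+1) //.
rewrite (@big_nat_recr _ _ _ N) // (@big_nat_recr _ _ _ N.*2.+2 N.+1) ?ltnS //.
rewrite (@big_nat_recr _ _ _ N.*2.+1 N.+1) // big_bool /=.
rewrite uphalf_double doubleK addn0 addn1 exprS.
move: (\prod_(0 <= k < N.*2.+1) _) (\prod_(0 <= k < N) _)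
  (\prod_(N.+1 <= k < N.*2.+1) _) IH => A B P IH.
have /gt_eqF/negbT m0 := Mf_gt0 (s N).
rewrite (_ : A * _ * _ * _ = (A * (Z * kap ^+ N)) * kap / Mf (s N) ^+ 2 *
  (M (s N) (s N.*2.+1) * f (s N.*2.+1) * (M (s N) (s N.*2.+2) * f (s N.*2.+2))));
  last by field.
rewrite IH {1}/Mf fE; field.
  by rewrite !gt_eqF.
exact: ltnW.
Qed.

Definition inner_weight (C : {fset vertex}) (s : config q) : R :=
  \prod_(x <- Ci C) \prod_(b : bool) M (s x) (s (rcons x b)).

(** [K] collects the edges whose upper end is outside the component, hence by [Ci_parent] also their
    lower end, and the leaf weights, whose indices are at least [N]. All edges meeting the component
    are thus in [inner_weight]. *)
Lemma chain_factorization (C : {fset vertex}) N : cutset C ->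
  (forall x, x \in Ci C -> (heap_index x < N)%N) ->
  exists K : config q -> R,
    (forall s s', (forall v, v \notin Ci C -> s v = s' v) -> K s = K s') /\
    forall s, chain (mkseq (s \o heap_vertex) N.*2.+1) = inner_weight C s * K s.
Proof.
move=> cC CN.
exists (fun s => (\prod_(0 <= k < N | heap_vertex k \notin Ci C)
    \prod_(b : bool) M (s (heap_vertex k)) (s (heap_vertex (k.*2 + b).+1)))
  * (\prod_(N <= k < N.*2.+1) f (s (heap_vertex k))) / (Z * kap ^+ N)).
have Z0 : Z * kap ^+ N != 0 by rewrite gt_eqF // mulr_gt0 // exprn_gt0.
split=> [s s' ss'|s].
  congr (_ * _ / _).
    apply: eq_bigr => k kC; apply: eq_bigr => b _; rewrite !ss' //.
    by rewrite heap_vertex_child; apply: contraNN kC; exact: Ci_parent.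
  apply: eq_big_nat => k /andP[Nk _]; rewrite ss' //; apply/negP => /CN.
  by rewrite heap_vertexK ltnNge Nk.
apply: (mulIf Z0); rewrite mulrA mulfVK // chain_heap mulrA; congr (_ * _).
rewrite (bigID (fun k => heap_vertex k \in Ci C)) /=; congr (_ * _).
rewrite /inner_weight (prod_fset_heap _ _ _ _ CN); apply: eq_bigr => k _.
by apply: eq_bigr => b _; rewrite -heap_vertex_child.
Qed.

Lemma boltzmann_weight_pair_potential (C : {fset vertex}) s (w : fin_config q C) :
  cutset C ->
  boltzmann_weight (pair_potential M) (pair_potential M) s w =
  inner_weight C (override q C w s).
Proof.
move=> cC; rewrite boltzmann_weightE //; apply: eq_bigr => x _.
by apply: eq_bigr => b _; rewrite if_same /pair_potential opprK lnK ?posrE.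
Qed.

Lemma inner_weight_gt0 C s : 0 < inner_weight C s.
Proof. by apply: prodr_gt0 => x _; apply: prodr_gt0. Qed.

End Chain.

(** * Events and functions that depend on finitely many spins *)

Section LocalEvents.
Variables (R : realType) (q : nat).
Implicit Types (B : set (config_space q)) (h : config_space q -> R).

Definition cylinder (w : seq 'Z_q) : set (config_space q) :=
  [set s | forall k, (k < size w)%N -> s (heap_vertex k) = nth 0 w k].

Definition agree (m : nat) (s s' : config q) : Prop :=
  forall v, (heap_index v < m)%N -> s v = s' v.

Definition local_set (m : nat) B : Prop := forall s s', agree m s s' -> B s -> B s'.

Definition of_seq (w : seq 'Z_q) : config_space q := fun v => nth 0 w (heap_index v).

Lemma agree_sym m s s' : agree m s s' -> agree m s' s.
Proof. by move=> ss' v vm; rewrite ss'. Qed.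

Lemma cylinder_agree (w : seq 'Z_q) s : cylinder w s <-> agree (size w) s (of_seq w).
Proof.
split=> h; first by move=> v vw; rewrite -{1}(heap_indexK v) h.
by move=> k kw; rewrite h ?heap_vertexK // /of_seq heap_vertexK.
Qed.

Lemma measurable_cylinder w : measurable (cylinder w).
Proof.
rewrite (_ : cylinder w = \bigcap_(k in `I_(size w))
    [set s | s (heap_vertex k) = nth 0 w k]); last by apply/seteqP; split.
apply: (@bigcap_measurableType _ (config_space q)) => k _.
by apply: sub_sigma_algebra; exists (heap_vertex k), (nth 0 w k).
Qed.

Lemma measurable_indic_cylinder (D : set (config_space q)) w :
  measurable_fun D (fun s => (\1_(cylinder w) s : R)%:E).
Proof.
apply/measurable_EFinP/measurable_indic; exact: measurable_cylinder.
Qed.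

Definition to_tuple m (s : config_space q) : m.-tuple 'Z_q :=
  [tuple s (heap_vertex k) | k < m].

Lemma agree_to_tuple m s : agree m s (of_seq (to_tuple m s)).
Proof.
move=> v vm; rewrite /of_seq.
by have /= := nth_mktuple (fun k : 'I_m => s (heap_vertex k)) 0 (Ordinal vm);
  rewrite heap_indexK => ->.
Qed.

Lemma cylinder_tuple m (t : m.-tuple 'Z_q) s : cylinder t s <-> t = to_tuple m s.
Proof.
rewrite cylinder_agree size_tuple; split=> [h|->]; last exact: agree_to_tuple.
apply: eq_from_tnth => k; rewrite tnth_mktuple h ?heap_vertexK // /of_seq.
by rewrite heap_vertexK (tnth_nth 0).
Qed.

Lemma measurable_local m B : local_set m B -> measurable B.
Proof.
move=> lB; rewrite (_ : B =
    \bigcup_(t in [set t : m.-tuple 'Z_q | B (of_seq t)]) cylinder t).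
  by apply: fin_bigcup_measurable => // t _; exact: measurable_cylinder.
apply/seteqP; split => s => [Bs|[t /= Bt] /cylinder_agree].
  exists (to_tuple m s); last exact/cylinder_tuple.
  exact: lB (agree_to_tuple _ _) Bs.
by rewrite size_tuple => /agree_sym /lB; apply.
Qed.

(** A local function is a finite combination of cylinder indicators, so its measurability and its
    integrals reduce to those of cylinders. *)
Lemma local_funE m h s : (forall s s', agree m s s' -> h s = h s') ->
  (h s)%:E = (\sum_(t : m.-tuple 'Z_q) ((h (of_seq t))%:E * (\1_(cylinder t) s)%:E))%E.
Proof.
move=> lh; have [t0 E0] : exists t0, t0 = to_tuple m s by eexists.
rewrite (bigD1 t0) //= big1 ?adde0 => [|t tn].
  rewrite indicE mem_set ?mule1; last exact/cylinder_tuple.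
  by rewrite E0 (lh _ _ (agree_to_tuple m s)).
rewrite indicE memNset ?mule0 // => /cylinder_tuple E.
by rewrite E0 E eqxx in tn.
Qed.

Lemma measurable_local_fun m h (D : set (config_space q)) : measurable D ->
  (forall s s', agree m s s' -> h s = h s') ->
  measurable_fun D (fun s : config_space q => (h s)%:E).
Proof.
move=> mD lh; rewrite (_ : (fun s => (h s)%:E) =
   fun s => (\sum_(t : m.-tuple 'Z_q) ((h (of_seq t))%:E * (\1_(cylinder t) s)%:E))%E).
  apply: emeasurable_sum => t _; apply: measurable_funeM => //.
  exact: measurable_indic_cylinder.
by apply/funext => s; exact: local_funE.
Qed.

Variable mu : probability (config_space q) R.

Lemma integral_local m B h : local_set m B -> (forall s, 0 <= h s) ->
  (forall s s', agree m s s' -> h s = h s') ->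
  (\int[mu]_(s in B) (h s)%:E = \sum_(t : m.-tuple 'Z_q | `[< B (of_seq t) >])
     (h (of_seq t))%:E * mu (cylinder t))%E.
Proof.
move=> lB h0 lh; have mB := measurable_local _ _ lB.
under eq_integral do rewrite (local_funE m) //.
rewrite ge0_integral_sum //=; last 2 first.
- move=> t; apply: measurable_funeM => //; exact: measurable_indic_cylinder.
- by move=> t s _; rewrite mule_ge0 // lee_fin // indicE.
rewrite [RHS]big_mkcond; apply: eq_bigr => t _ /=.
rewrite ge0_integralZl_EFin //=; last first.
  exact: measurable_indic_cylinder.
rewrite integral_indic //; last exact: measurable_cylinder.
case: asboolP => [Bt|Bt].
  congr (_ * mu _)%E; apply/setIidPl => s /cylinder_agree.
  by rewrite size_tuple => /agree_sym /lB; apply.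
rewrite (_ : _ `&` _ = set0) ?measure0 ?mule0 //; apply/seteqP; split => // s [].
by move=> /cylinder_agree; rewrite size_tuple => /lB + /[dup] Bs => /(_ Bs).
Qed.

Lemma measure_local m B : local_set m B ->
  mu B = (\sum_(t : m.-tuple 'Z_q | `[< B (of_seq t) >]) mu (cylinder t))%E.
Proof.
move=> lB; rewrite -[LHS]mul1e -integral_cst; last exact: measurable_local lB.
by rewrite (integral_local m B (fun=> 1)) //; under eq_bigr do rewrite mul1e.
Qed.

End LocalEvents.

Section OverrideTheory.
Variables (q : nat) (C : {fset vertex}).
Implicit Types (w : fin_config q C) (s : config q).

Lemma override_override w w' s : override q C w (override q C w' s) = override q C w s.
Proof.
apply/funext => v; have [vC|vC] := boolP (v \in Ci C); last first.
  by rewrite !override_out.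
by rewrite -[v]/(val [` vC]%fset) !override_in.
Qed.

Lemma override_extends w s : extends w s -> override q C w s = s.
Proof.
move=> ws; apply/funext => v; have [vC|vC] := boolP (v \in Ci C); last first.
  by rewrite override_out.
by rewrite -[v]/(val [` vC]%fset) override_in ws.
Qed.

Lemma extends_override w s : extends w (override q C w s).
Proof. by move=> x; rewrite override_in. Qed.

(** The bound [N] keeps the children of [S] among the first [2N + 1] vertices, the range of
    [chain_heap]; the bound on [m] makes a given local event fit in the same range. *)
Lemma fset_heap_bound (S : {fset vertex}) m :
  exists2 N, (m <= N.*2.+1)%N & forall x, x \in S -> (heap_index x < N)%N.
Proof.
exists (m + \max_(x <- S) (heap_index x).+1)%N; first by lia.
move=> x xS; apply: (@leq_trans (\max_(x <- S) (heap_index x).+1)); last exact: leq_addl.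
exact: (@leq_bigmax_seq vertex (enum_fset S) xpredT (fun x => (heap_index x).+1)).
Qed.

End OverrideTheory.

(** * Conditional distributions of the chain measure *)

Section Gibbs.
Variables (R : realType) (q : nat) (M : spin_matrix R q) (f : 'Z_q -> R) (kap : R).
Hypothesis M_gt0 : forall i j, 0 < M i j.
Hypothesis f_gt0 : forall i, 0 < f i.
Hypothesis fE : forall i, (\sum_j M i j * f j) ^+ 2 = kap * f i.
Variable mu : probability (config_space q) R.
Hypothesis muE : forall w, mu (cylinder q w) = (chain R q M f w)%:E.

Section OneCutset.
Variables (C : {fset vertex}) (cC : cutset C) (w : fin_config q C).
Local Notation ov := (override q C).
Local Notation iw := (inner_weight R q M C).
Local Notation gam s := (fin_gibbs (pair_potential M) (pair_potential M) s w).

Let total (s : config q) := \sum_(w' : fin_config q C) iw (ov w' s).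

Let total_gt0 s : 0 < total s.
Proof.
rewrite /total (bigD1 w) //= ltr_pwDl ?inner_weight_gt0 // sumr_ge0 // => w' _.
by apply: ltW; exact: inner_weight_gt0.
Qed.

Let gamE s : gam s = iw (ov w s) / total s.
Proof.
rewrite /fin_gibbs boltzmann_weight_pair_potential //; congr (_ / _).
by apply: eq_bigr => w' _; rewrite boltzmann_weight_pair_potential.
Qed.

Let gam_ge0 s : 0 <= gam s.
Proof. by rewrite gamE divr_ge0 ?ltW // inner_weight_gt0. Qed.

Let to_tuple_of_seq n (t : n.-tuple 'Z_q) : to_tuple q n (of_seq q t) = t.
Proof.
apply: eq_from_tnth => k.
by rewrite tnth_mktuple /of_seq heap_vertexK (tnth_nth 0).
Qed.

Section Bounded.
Variables (N : nat) (CN : forall x, x \in Ci C -> (heap_index x < N)%N).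
Local Notation n := (N.*2.+1).

Let iw_agree s s' : agree q n s s' -> iw s = iw s'.
Proof.
move=> ss'; rewrite /inner_weight [in LHS]big_seq [in RHS]big_seq.
apply: eq_bigr => x /CN xN; apply: eq_bigr => b _.
rewrite !ss' //; last by lia.
by rewrite heap_index_rcons; case: b; lia.
Qed.

Let ov_agree w' s s' : agree q n s s' -> agree q n (ov w' s) (ov w' s').
Proof. by move=> ss' v vn; rewrite /override; case: insubP => //= _; rewrite ss'. Qed.

Let gam_agree s s' : agree q n s s' -> gam s = gam s'.
Proof.
move=> ss'; rewrite !gamE (iw_agree _ _ (ov_agree w _ _ ss')); congr (_ / _).
by apply: eq_bigr => w' _; apply/iw_agree/ov_agree.
Qed.

Let put (w' : fin_config q C) (t : n.-tuple 'Z_q) := to_tuple q n (ov w' (of_seq q t)).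

Let of_seq_put w' t : of_seq q (put w' t) = ov w' (of_seq q t).
Proof.
apply/funext => v; have [vn|nv] := ltnP (heap_index v) n.
  by rewrite -(agree_to_tuple q n).
rewrite override_out; last by apply/negP => /CN; lia.
by rewrite /of_seq !nth_default // size_tuple.
Qed.

(** The tuples are grouped by their spins outside the component. On a group, [gam] and the factor
    [K] of the chain are constant, so the sum of the inner weights cancels the partition function
    [total]. What is left is the chain at the member of the group that carries [w] inside. *)
Lemma fin_gibbs_sum (B : set (config_space q)) :
  (forall s s', (forall v, v \notin Ci C -> s v = s' v) -> B s -> B s') ->
  \sum_(t : n.-tuple 'Z_q | `[< B (of_seq q t) >])
    gam (of_seq q t) * chain R q M f t =
  \sum_(t : n.-tuple 'Z_q | `[< (extends w `&` B) (of_seq q t) >]) chain R q M f t.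
Proof.
move=> lB; have [K [Kout KE]] := chain_factorization _ _ _ _ _ M_gt0 f_gt0 fE C N cC CN.
have Bov w' s : B s -> B (ov w' s).
  by apply: lB => v vC; rewrite override_out.
have chainE (t : n.-tuple 'Z_q) :
    chain R q M f t = iw (of_seq q t) * K (of_seq q t).
  rewrite -KE; congr chain; apply: (@eq_from_nth _ 0).
    by rewrite size_mkseq size_tuple.
  move=> k; rewrite size_tuple => kn.
  by rewrite nth_mkseq //= /of_seq heap_vertexK.
rewrite (partition_big (put w)
  (fun t => `[< (extends w `&` B) (of_seq q t) >])) /=; last first.
  move=> t /asboolP Bt; apply/asboolP; rewrite of_seq_put.
  by split; [exact: extends_override|exact: Bov].
apply: eq_bigr => t /asboolP[/override_extends wt Bt].
pose restr (u : n.-tuple 'Z_q) : fin_config q C := [ffun x => of_seq q u (val x)].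
(* The group of [t] is parametrized by the inner configurations [w']. *)
rewrite (reindex_onto (fun w' => put w' t) restr); last first.
  move=> u /andP[_ /eqP <-]; rewrite -[RHS]to_tuple_of_seq /put of_seq_put.
  rewrite override_override override_extends // => x.
  by rewrite ffunE.
rewrite (eq_bigl xpredT) => [|w']; last first.
  apply/andP; split; last first.
    by apply/eqP/ffunP => x; rewrite ffunE of_seq_put override_in.
  apply/andP; split; first by apply/asboolP; rewrite of_seq_put; exact: Bov.
  by rewrite -[X in _ == X]to_tuple_of_seq {1}/put of_seq_put override_override wt.
transitivity (\sum_(w' : fin_config q C)
    chain R q M f t / total (of_seq q t) * iw (ov w' (of_seq q t))).
  apply: eq_bigr => w' _; rewrite gamE !chainE of_seq_put override_override wt.
  have -> : total (ov w' (of_seq q t)) = total (of_seq q t).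
    by apply: eq_bigr => w'' _; rewrite override_override.
  rewrite (Kout (ov w' _) (of_seq q t)) => [|v vC]; last by rewrite override_out.
  by rewrite -!mulrA; congr (_ * _); rewrite mulrCA mulrC -!mulrA mulrCA.
by rewrite -mulr_sumr mulfVK // gt_eqF.
Qed.

Lemma fin_gibbs_local (B : set (config_space q)) : local_set q n B ->
  (forall s s', (forall v, v \notin Ci C -> s v = s' v) -> B s -> B s') ->
  mu (extends w `&` B) = (\int[mu]_(s in B) (gam s)%:E)%E.
Proof.
move=> lB oB; rewrite (integral_local R q mu n) //.
rewrite (measure_local R q mu n); last first.
  move=> s s' ss' [ws Bs]; split; last exact: lB ss' Bs.
  move=> x; rewrite -ws -ss' //.
  by have := CN _ (valP x); lia.
under eq_bigr do rewrite muE.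
under [RHS]eq_bigr do rewrite muE -EFinM.
by rewrite !sumEFin fin_gibbs_sum.
Qed.

Lemma measurable_fin_gibbs (D : set (config_space q)) : measurable D ->
  measurable_fun D (fun s : config_space q => (gam s)%:E).
Proof. by move=> mD; apply: (@measurable_local_fun _ _ n). Qed.

End Bounded.

(** Cylinders on one vertex are not closed under intersection. This larger class is, as the Dynkin
    argument requires. *)
Definition outside_local : set (set (config_space q)) :=
  [set B | exists m, forall s s',
    (forall v, v \notin Ci C -> (heap_index v < m)%N -> s v = s' v) -> B s -> B s'].

Lemma outside_localI : setI_closed outside_local.
Proof.
move=> A B [m Am] [n Bn]; exists (maxn m n) => s s' ss' [As Bs]; split.
  by apply: Am As => v vC vm; apply: ss' => //; lia.
by apply: Bn Bs => v vC vn; apply: ss' => //; lia.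
Qed.

Lemma measurable_outside_local B : <<s outside_local >> B -> measurable B.
Proof.
apply: smallest_sub; first exact: smallest_sigma_algebra.
move=> {}B [m Bm]; apply: (@measurable_local _ m) => s s' ss'.
by apply: Bm => v _; exact: ss'.
Qed.

Lemma cylinders_outside_local B :
  <<s cylinders (~` [set` Ci C]) >> B -> <<s outside_local >> B.
Proof.
apply: sub_sigma_algebra2 => _ [v [a [vC ->]]].
by exists (heap_index v).+1 => s s' /= <- //; exact/negP.
Qed.

Let mext : measurable (extends w : set (config_space q)).
Proof.
have [N _ CN] := fset_heap_bound (Ci C) 0.
apply: (@measurable_local _ N) => s s' ss' ws x.
by rewrite -ws ss' //; exact: CN (valP x).
Qed.

Lemma fin_gibbs_conditional (B : set (config_space q)) :
  <<s cylinders (~` [set` Ci C]) >> B ->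
  mu (extends w `&` B) = (\int[mu]_(s in B) (gam s)%:E)%E.
Proof.
move=> /cylinders_outside_local.
have mgam (D : set (config_space q)) : measurable D ->
    measurable_fun D (fun s : config_space q => (gam s)%:E).
  have [N _ CN] := fset_heap_bound (Ci C) 0.
  exact: (measurable_fin_gibbs N CN).
have gam0 (s : config_space q) : (0 <= (gam s)%:E)%E by rewrite lee_fin.
have Plocal A : outside_local A ->
    mu (extends w `&` A) = (\int[mu]_(s in A) (gam s)%:E)%E.
  move=> [m Am]; have [N mN CN] := fset_heap_bound (Ci C) m.
  apply: (fin_gibbs_local N CN) => s s' ss'; apply: Am => v vC.
    by move=> vm; apply: ss'; lia.
  by move=> _; exact: ss'.
have PT : mu (extends w `&` setT) = (\int[mu]_s (gam s)%:E)%E.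
  by apply: Plocal; exists 0%N.
move: B; apply: (@dynkin_induction _ (g_sigma_algebraType outside_local) outside_local
  (fun S : set (config_space q) =>
     mu (extends w `&` S) = (\int[mu]_(s in S) (gam s)%:E)%E)) => //.
- exact: outside_localI.
- move=> S /measurable_outside_local mS PS.
  have mw := measurableI _ _ mext mS.
  have fS : mu (extends w `&` S) \is a fin_num by exact: fin_num_measure.
  (* Adding the finite mass of the part in [S] to both sides reduces the complement to the whole
     space, that is to [PT]. *)
  rewrite -[LHS](addeK _ fS) -[RHS](addeK _ fS); congr (_ - _)%E.
  rewrite [in RHS]PS -measureU //; last 2 first.
  + exact/measurableI/measurableC.
  + by rewrite setIACA setIid setICl setI0.
  rewrite -setIUr setvU [LHS]PT -ge0_integral_setU ?setvU //.
  + exact: measurableC.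
  + exact: mgam.
  + by apply/disj_set2P; rewrite setICl.
- move=> F mF tF PF.
  have mF' k : measurable (F k : set (config_space q)).
    exact: measurable_outside_local (mF k).
  rewrite ge0_integral_bigcup //; last first.
    by apply: mgam; apply: bigcup_measurable => k _; exact: mF'.
  have mwF k : measurable (extends w `&` (F k : set (config_space q))).
    by apply: measurableI.
  rewrite setI_bigcupr measure_semi_bigcup //.
  + by apply: eq_eseriesr => k _; exact: PF.
  + exact: trivIset_setIl.
  + exact: bigcup_measurable.
Qed.

End OneCutset.

Lemma chain_is_gibbs : is_gibbs (pair_potential M) mu.
Proof. by move=> C cC w B; exact: fin_gibbs_conditional. Qed.

End Gibbs.

Lemma fixed_point_gibbs (R : realType) (q : nat) (M : spin_matrix R q)
    (f : 'Z_q -> R) (kap : R) :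
  (forall i j, 0 < M i j) -> (forall i, 0 < f i) ->
  (forall i, (\sum_j M i j * f j) ^+ 2 = kap * f i) ->
  exists2 mu : probability (config_space q) R, is_gibbs (pair_potential M) mu &
    forall a, mu [set s | s origin = a] = (f a / \sum_i f i)%:E.
Proof.
move=> M0 f0 fE.
have [w||w|mu muE] := config_measure_exists R q (chain R q M f).
- exact: chain_ge0 M0 f0 w.
- exact: chain_nil.
- exact: chain_rcons M0 f0 fE w.
exists mu; first exact: chain_is_gibbs M0 f0 fE mu muE.
move=> a; have := muE [:: a]; rewrite /chain /= big_nat1 /= => <-.
congr (mu _); apply/seteqP; split => s /=; first by move=> sa [|].
by move=> /(_ 0%N isT).
Qed.

Lemma fixed_point_phase_transition (R : realType) (q : nat) (M : spin_matrix R q)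
    (f : 'Z_q -> R) (kap : R) (a b : 'Z_q) :
  (forall i j, 0 < M i j) -> (forall i, \sum_j M i j = 1) ->
  (forall i, 0 < f i) ->
  (forall i, (\sum_j M i j * f j) ^+ 2 = kap * f i) ->
  f a != f b -> phase_transition (pair_potential M).
Proof.
move=> M0 M1 f0 fE fab.
have [mu mug muE] := fixed_point_gibbs _ _ M f kap M0 f0 fE.
have [|i|nu nug nuE] := fixed_point_gibbs _ _ M (fun=> 1) 1 M0.
- by [].
- by under eq_bigr do rewrite mulr1; rewrite M1 expr1n mulr1.
exists mu, nu; split => //; have mev c : measurable [set s : config_space q | s origin = c].
  by apply: sub_sigma_algebra; exists origin, c.
(* The root is uniform under [nu]; if the two root laws agreed at both [a] and [b], then
   [f a = f b]. *)
have [ha|ha] := eqVneq (mu [set s | s origin = a]) (nu [set s | s origin = a]);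
  last by exists [set s | s origin = a] => //; exact/eqP.
exists [set s | s origin = b] => // hb; move/eqP: fab; apply.
have Z0 : \sum_i f i != 0.
  by rewrite gt_eqF // (bigD1 0) //= ltr_pwDl // sumr_ge0 // => i _; exact: ltW.
by move: ha hb; rewrite !muE !nuE => -[<-] [] /(mulIf (invr_neq0 Z0)).
Qed.

(** * Message passing from a level of the tree *)

Fixpoint short_words (n : nat) : seq vertex :=
  if n is m.+1 then
    [::] :: map (cons false) (short_words m) ++ map (cons true) (short_words m)
  else [::].

Lemma mem_short_words n v : (v \in short_words n) = (size v < n)%N.
Proof.
elim: n v => [|n IH] v; first by rewrite in_nil ltn0.
rewrite /= inE mem_cat; case: v => [|b v] //=.
have inj b' : injective (cons b' : vertex -> vertex) by move=> x y [].
have neg b' : b' != b -> (b :: v \in map (cons b') (short_words n)) = false.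
  by move=> b'b; apply/negP => /mapP[x _ [/eqP]]; rewrite eq_sym (negbTE b'b).
by case: b neg => neg; [rewrite (neg false)|rewrite (neg true)] => //;
  rewrite mem_map // IH ltnS ?orbF.
Qed.

Lemma uniq_short_words n : uniq (short_words n).
Proof.
elim: n => [|n IH] //=; rewrite mem_cat cat_uniq !map_inj_uniq ?IH; last 2 first.
- by move=> x y [].
- by move=> x y [].
rewrite andbT /=; apply/andP; split.
  by apply/negP => /orP[] /mapP[].
by apply/hasPn => _ /mapP[x _ ->]; apply/negP => /mapP[].
Qed.

Definition level (n : nat) : {fset vertex} :=
  [fset v in [seq v <- short_words n.+1 | size v == n]]%fset.

Lemma in_level n v : (v \in level n) = (size v == n).
Proof.
rewrite inE mem_filter mem_short_words ltnS.
by case: eqVneq => //= ->; rewrite leqnn.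
Qed.

Lemma size_adj x y : adj x y -> size y = (size x).+1 \/ size x = (size y).+1.
Proof.
by case/orP => /orP[] /eqP ->; rewrite size_rcons; [left|left|right|right].
Qed.

(** A ray missing the level starts above it and changes its depth by one at each step, so it stays
    among finitely many vertices, against injectivity. *)
Lemma cutset_level n : cutset (level n).
Proof.
split; last first.
  by move=> [x [y [+ + + _]]]; rewrite !in_level => /eqP -> /eqP ->; rewrite ltnn.
move=> p [p0 padj pinj]; apply: contrapT => np.
have pn k : size (p k) != n.
  by apply/negP => pk; apply: np; exists k; rewrite in_level.
have small k : p k \in short_words n.
  rewrite mem_short_words; elim: k => [|k IH].
    by have := pn 0%N; rewrite p0 /= lt0n eq_sym.
  have := size_adj _ _ (padj k); have := pn k.+1.
  by move: IH; move: (size (p k)) (size (p k.+1)) => a b; lia.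
have := @uniq_leq_size _ (map p (iota 0 (size (short_words n)).+1)) (short_words n).
rewrite map_inj_uniq // iota_uniq size_map size_iota => /(_ isT).
have sub : {subset map p (iota 0 (size (short_words n)).+1) <= short_words n}.
  by move=> _ /mapP[k _ ->].
by move=> /(_ sub); rewrite ltnn.
Qed.

Lemma in_Ci_level n v : (v \in Ci (level n.+1)) = (size v < n.+1)%N.
Proof.
have cC := cutset_level n.+1; apply/idP/idP.
  rewrite in_Ci // inE => /component_prefix h; rewrite ltnNge; apply/negP => nv.
  by have := h _ (prefix_take v n.+1); rewrite in_level size_takel ?eqxx.
elim/last_ind: v => [|v b IH] vn.
  by rewrite in_Ci // inE; exists [::]; split; rewrite //= in_level.
have vC : v \in Ci (level n.+1) by apply: IH; rewrite size_rcons in vn; lia.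
apply: Ci_adj vC _ _ => //; last by rewrite in_level; lia.
by rewrite /adj /child; case: b {vn}; rewrite eqxx ?orbT.
Qed.

Section TreeSum.
Variables (R : realType) (q : nat) (M : 'Z_q -> 'Z_q -> R) (V : 'Z_q -> R).

(* Configurations on the words of length less than [n]. *)
Fixpoint tree (n : nat) : finType :=
  if n is m.+1 then ('Z_q * (tree m * tree m))%type else unit.

(** The default [0] beyond the depth [n] is also the boundary condition, so that the result already
    carries the right spins on the cutset. *)
Fixpoint read (n : nat) : tree n -> config q :=
  match n with
  | 0 => fun _ _ => 0
  | m.+1 => fun t v =>
    if v is b :: v' then read m (if b then t.2.2 else t.2.1) v' else t.1
  end.

Fixpoint encode (n : nat) (s : config q) : tree n :=
  match n with
  | 0 => tt
  | m.+1 => (s [::], (encode m (fun v => s (false :: v)),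
                      encode m (fun v => s (true :: v))))
  end.

Lemma read_long n (t : tree n) v : (n <= size v)%N -> read n t v = 0.
Proof. by elim: n t v => [|n IH] t [|b v] //= nv; exact: IH. Qed.

Lemma encodeK n s v : (size v < n)%N -> read n (encode n s) v = s v.
Proof.
by elim: n s v => [|n IH] s [|b v] //= nv; case: b; rewrite IH.
Qed.

Lemma readK n (t : tree n) : encode n (read n t) = t.
Proof.
elim: n t => [|n IH] /=; first by case.
by move=> [a [l r]] /=; congr (_, (_, _)); exact: IH.
Qed.

(** Here [i] is the spin just above the branch, and the edge from it is included. With no level
    left, only the edge to the cutset remains, of weight [V i]. *)
Fixpoint branch_weight (n : nat) (i : 'Z_q) (s : config q) : R :=
  if n is m.+1 then M i (s [::]) *
    (branch_weight m (s [::]) (fun v => s (false :: v)) *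
     branch_weight m (s [::]) (fun v => s (true :: v)))
  else V i.

Fixpoint branch_sum (n : nat) (i : 'Z_q) : R :=
  if n is m.+1 then \sum_a M i a * (branch_sum m a) ^+ 2 else V i.

Lemma sum_branch_pair n a (F : 'Z_q -> tree n -> R) :
  \sum_(t : tree n.+1 | t.1 == a) F t.1 t.2.1 * F t.1 t.2.2 = (\sum_t F a t) ^+ 2.
Proof.
transitivity (\sum_(p : 'Z_q * (tree n * tree n) | pred1 a p.1 && xpredT p.2)
    F p.1 p.2.1 * F p.1 p.2.2); first by apply: eq_bigl => p; rewrite andbT.
rewrite -(pair_big (pred1 a) xpredT
  (fun b (t : tree n * tree n) => F b t.1 * F b t.2)) /= big_pred1_eq.
rewrite -(pair_bigA _ (fun l r => F a l * F a r)) /= expr2 mulr_suml.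
by apply: eq_bigr => l _; rewrite mulr_sumr.
Qed.

Lemma sum_branch_weight n i :
  \sum_(t : tree n) branch_weight n i (read n t) = branch_sum n i.
Proof.
elim: n i => [|n IH] i /=; first by rewrite big_const card_unit /= addr0.
rewrite (partition_big (fun t : tree n.+1 => t.1) xpredT) //=.
apply: eq_bigr => a _; rewrite -IH.
rewrite -(sum_branch_pair n a (fun i t => branch_weight n i (read n t))) mulr_sumr.
by apply: eq_bigr => t /eqP <-.
Qed.

Lemma prod_short_words n s :
  \prod_(x <- short_words n.+1) \prod_(b : bool)
     (if (size (rcons x b) < n.+1)%N then M (s x) (s (rcons x b)) else V (s x)) =
  branch_weight n (s [::]) (fun v => s (false :: v)) *
  branch_weight n (s [::]) (fun v => s (true :: v)).
Proof.
elim: n s => [|n IH] s; first by rewrite /= big_seq1 big_bool.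
rewrite (_ : short_words n.+2 = [::] :: map (cons false) (short_words n.+1) ++
  map (cons true) (short_words n.+1)) // big_cons big_cat !big_map big_bool.
transitivity (M (s [::]) (s [:: true]) * M (s [::]) (s [:: false]) *
  (branch_weight n (s [:: false]) (fun v => s [:: false, false & v]) *
   branch_weight n (s [:: false]) (fun v => s [:: false, true & v]) *
  (branch_weight n (s [:: true]) (fun v => s [:: true, false & v]) *
   branch_weight n (s [:: true]) (fun v => s [:: true, true & v])))).
  congr (_ * (_ * _)); first exact: (IH (fun v => s (false :: v))).
  exact: (IH (fun v => s (true :: v))).
by rewrite /= [M _ _ * M _ _]mulrC mulrACA.
Qed.

End TreeSum.

(** There is no edge above the root: its two branches meet in a square without a further application
    of [M]. Hence level [n + 1] takes [n] steps of the recursion. *)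
Lemma root_marginal_level (R : realType) (q : nat) (M : spin_matrix R q) (u : R)
    (n : nat) (a : 'Z_q) : (forall i j, 0 < M i j) ->
  let T := branch_sum R q M (fun i => expR (- (u * pair_potential M i 0))) n in
  root_marginal u (pair_potential M) (level n.+1) a = T a ^+ 2 / \sum_b T b ^+ 2.
Proof.
move=> M0 T; pose V i := expR (- (u * pair_potential M i 0)); set C := level n.+1.
have cC : cutset C by exact: cutset_level.
pose conf (t : tree q n.+1) : fin_config q C := [ffun x => read q n.+1 t (val x)].
have confK t : override q C (conf t) (fun=> 0) = read q n.+1 t.
  apply/funext => v; have [vC|vC] := boolP (v \in Ci C).
    by rewrite -[v]/(val [` vC]%fset) override_in ffunE.
  rewrite override_out // read_long //.
  by move: vC; rewrite in_Ci_level -leqNgt.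
have bij_conf : bijective conf.
  exists (fun w => encode q n.+1 (override q C w (fun=> 0))) => [t|w].
    by rewrite confK readK.
  apply/ffunP => x; rewrite ffunE encodeK ?override_in //.
  by have := valP x; rewrite in_Ci_level.
pose W (w : fin_config q C) := boltzmann_weight (pair_potential M)
  (fun i j => u * pair_potential M i j) (fun=> 0) w.
have WE t : W (conf t) = branch_weight R q M V n t.1 (read q n t.2.1) *
                         branch_weight R q M V n t.1 (read q n t.2.2).
  rewrite /W boltzmann_weightE // confK.
  rewrite -[RHS](prod_short_words _ _ _ _ n (read q n.+1 t)).
  rewrite (perm_big (short_words n.+1)); last first.
    apply: uniq_perm; [exact: fset_uniq|exact: uniq_short_words|] => x.
    by rewrite mem_short_words -in_Ci_level.
  apply: eq_big_seq => x; rewrite mem_short_words => xn.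
  apply: eq_bigr => b _; rewrite in_Ci_level; case: ltnP => xb.
    by rewrite /pair_potential opprK lnK ?posrE.
  by rewrite (read_long _ _ _ (rcons x b)).
have sumW b : \sum_(t : tree q n.+1 | t.1 == b) W (conf t) = T b ^+ 2.
  under eq_bigr do rewrite WE.
  rewrite (sum_branch_pair _ _ _ b (fun i t => branch_weight R q M V n i (read q n t))).
  by rewrite sum_branch_weight.
have total : \sum_w W w = \sum_b T b ^+ 2.
  rewrite (reindex conf) /=; last exact: onW_bij.
  rewrite (partition_big (fun t : tree q n.+1 => t.1) xpredT) //=.
  by apply: eq_bigr => b _; rewrite -sumW.
rewrite /root_marginal /fin_gibbs -mulr_suml -/W total; congr (_ / _).
rewrite (reindex conf) /=; last exact: onW_bij.
rewrite -sumW; apply: eq_bigl => t.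
have oC : origin \in Ci C by rewrite in_Ci_level.
apply/existsP/eqP => [[x /andP[/eqP xo /eqP <-]]|ta].
  by rewrite ffunE -[\val x]/(fsval x) xo.
exists [` oC]%fset; apply/andP; split => //.
by apply/eqP; rewrite ffunE -ta.
Qed.

(** * Absence of robust phase transition *)

Lemma expR_small_perturbation (R : realType) (I : finType) (h : I -> R) (e : R) :
  0 < e -> exists2 u, 0 < u <= 1 & forall i, `|expR (u * h i) - 1| <= e.
Proof.
move=> e0.
have : \forall t \near (0 : R), `|expR t - 1| <= e.
  have := @continuous_expR R 0; rewrite /continuous_at expR0 => /cvgrPdist_le /(_ _ e0).
  by apply: filterS => t; rewrite distrC.
move=> /nbhs_ballP[d /= d0 hd].
have [L L0 hL] : exists2 L : R, 0 < L & forall i, `|h i| <= L.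
  have S0 : 0 <= \sum_i `|h i| by exact: sumr_ge0.
  exists (1 + \sum_i `|h i|) => [|i]; first by lra.
  have : `|h i| <= \sum_i `|h i| by rewrite (bigD1 i) //= lerDl sumr_ge0.
  by lra.
(* As [L] bounds every [|h i|], this [u] keeps [u * |h i|] within half the radius [d]. *)
have u0 : 0 < Num.min 1 (d / (2 * L)).
  by rewrite lt_min ltr01 divr_gt0 // mulr_gt0.
exists (Num.min 1 (d / (2 * L))); first by rewrite u0 ge_min lexx.
move=> i; apply: hd; rewrite /ball /= sub0r normrN normrM (gtr0_norm u0).
apply: (@le_lt_trans _ _ (d / (2 * L) * L)).
  by apply: ler_pM => //; [exact: ltW|rewrite ge_min lexx orbT].
by rewrite invfM mulrA mulfVK ?gt_eqF // ltr_pdivrMr // ltr_pMr // ltr1n.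
Qed.

(** * Contraction of even messages, for four and five states at once *)

Section NoRobust.
Variables (R : realType) (q : nat) (M : spin_matrix R q).
Variables (c1 c2 : 'Z_q -> R) (l1 l2 l : R) (kap P1 P2 : R -> R -> R).
Hypothesis card_spin : #|'Z_q| = q.
Hypothesis M_gt0 : forall i j, 0 < M i j.
Hypothesis M_sum : forall a : 'Z_q, \sum_b M a b = 1.
Hypothesis M_even : forall a : 'Z_q, M a 0 = M (- a) 0.
Hypothesis Mc1 : forall a : 'Z_q, \sum_b M a b * c1 b = l1 * c1 a.
Hypothesis Mc2 : forall a : 'Z_q, \sum_b M a b * c2 b = l2 * c2 a.
Hypothesis c1_sum : \sum_a c1 a = 0.
Hypothesis c2_sum : \sum_a c2 a = 0.
Hypothesis c1_le2 : forall a, `|c1 a| <= 2.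
Hypothesis c2_le2 : forall a, `|c2 a| <= 2.
Hypothesis square_expansion : forall x y a,
  (1 + x * c1 a + y * c2 a) ^+ 2 = kap x y + P1 x y * c1 a + P2 x y * c2 a.
Hypothesis kap_ge1 : forall x y, 1 <= kap x y.
Hypothesis P_bound : forall x y s : R, `|x| <= s -> `|y| <= s ->
  `|P1 x y| <= s * (2 + 3 * s) /\ `|P2 x y| <= s * (2 + 3 * s).
Hypothesis l1_le : `|l1| <= l.
Hypothesis l2_le : `|l2| <= l.
Hypothesis l_lt : 2 * l < 1.
Hypothesis even_expansion : forall (v : 'Z_q -> R) (e : R), (forall a, v a = v (- a)) ->
  (forall a, `|v a - 1| <= e) -> exists A X Y,
  [/\ forall a, v a = A + X * c1 a + Y * c2 a, `|A - 1| <= e, `|X| <= e & `|Y| <= e].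

Let l_ge0 : 0 <= l. Proof. exact: le_trans (normr_ge0 _) l1_le. Qed.

Lemma ratio_le (p k s : R) : `|p| <= s -> 1 <= k -> `|p / k| <= s.
Proof.
move=> ps k1; have k0 : 0 < k by lra.
rewrite normrM normfV (ger0_norm (ltW k0)) ler_pdivrMr //.
by apply: (le_trans ps); rewrite ler_peMr // (le_trans _ ps).
Qed.

(** One step maps the coefficients to [l1 * P1 / kap] and [l2 * P2 / kap]. In [2 + 3 * s], the [2]
    is the linear part of squaring and [3 * s] bounds the quadratic terms; dividing by [kap >= 1]
    only helps. *)
Lemma branch_sum_contraction (V : 'Z_q -> R) A x y s n :
  0 < A -> (forall a, V a = A * (1 + x * c1 a + y * c2 a)) ->
  `|x| <= s -> `|y| <= s -> l * (2 + 3 * s) <= 1 ->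
  exists A' x' y', [/\ 0 < A',
    forall a, branch_sum R q M V n a = A' * (1 + x' * c1 a + y' * c2 a),
    `|x'| <= (l * (2 + 3 * s)) ^+ n * s & `|y'| <= (l * (2 + 3 * s)) ^+ n * s].
Proof.
move=> A0 VE xs ys rho1; have s0 : 0 <= s by exact: le_trans (normr_ge0 _) xs.
have rho0 : 0 <= l * (2 + 3 * s) by rewrite mulr_ge0 //; lra.
elim: n => [|n [B [x' [y' [B0 BE x's y's]]]]].
  by exists A, x, y; rewrite expr0 mul1r.
have k1 := kap_ge1 x' y'; have k0 : 0 < kap x' y' by lra.
exists (B ^+ 2 * kap x' y'), (l1 * P1 x' y' / kap x' y'), (l2 * P2 x' y' / kap x' y').
set t := (l * (2 + 3 * s)) ^+ n * s in x's y's *.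
have ts : t <= s by rewrite ler_piMl // exprn_ile1.
have t0 : 0 <= t by rewrite mulr_ge0 // exprn_ge0.
have [p1 p2] := P_bound _ _ _ x's y's.
have bound (p lj : R) : `|lj| <= l -> `|p| <= t * (2 + 3 * t) ->
    `|lj * p / kap x' y'| <= (l * (2 + 3 * s)) ^+ n.+1 * s.
  move=> ljl pt; apply: ratio_le => //; rewrite normrM exprS -mulrA -/t.
  rewrite -mulrA; apply: ler_pM => //; apply: (le_trans pt).
  by rewrite mulrC ler_wpM2r //; lra.
split; [by rewrite mulr_gt0 // exprn_gt0| |exact: bound|exact: bound].
move=> a /=.
transitivity (B ^+ 2 * (kap x' y' * \sum_b M a b +
    P1 x' y' * \sum_b M a b * c1 b + P2 x' y' * \sum_b M a b * c2 b)).
  rewrite !mulr_sumr -!big_split mulr_sumr /=; apply: eq_bigr => b _.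
  by rewrite BE exprMn square_expansion; ring.
by rewrite M_sum Mc1 Mc2; field; rewrite gt_eqF.
Qed.

(** Since [c1] and [c2] sum to zero, subtracting [1/q] from the marginal leaves only their two
    terms. Each is at most [5 * t * 2], because [2 + 3 * t <= 5] and the characters are bounded by
    [2]; hence the [20]. *)
Lemma level_dist_to_uniform (u : R) A x y s n :
  0 < A -> (forall a, expR (- (u * pair_potential M a 0)) = A * (1 + x * c1 a + y * c2 a)) ->
  `|x| <= s -> `|y| <= s -> l * (2 + 3 * s) <= 1 -> s <= 1 ->
  dist_to_uniform (root_marginal u (pair_potential M) (level n.+1))
    <= 20 * ((l * (2 + 3 * s)) ^+ n * s).
Proof.
move=> A0 VE xs ys rho1 s1.
have s0 : 0 <= s by exact: le_trans (normr_ge0 _) xs.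
have rho0 : 0 <= l * (2 + 3 * s) by rewrite mulr_ge0 //; lra.
have [B [x' [y' [B0 BE x's y's]]]] := branch_sum_contraction _ _ _ _ _ n A0 VE xs ys rho1.
set t := (l * (2 + 3 * s)) ^+ n * s in x's y's *.
have ts : t <= s by rewrite ler_piMl // exprn_ile1.
have t0 : 0 <= t by rewrite mulr_ge0 // exprn_ge0.
have k1 := kap_ge1 x' y'; have k0 : 0 < kap x' y' by lra.
have [p1 p2] := P_bound _ _ _ x's y's.
have q1 : (1 : R) <= q%:R by rewrite -card_spin card_ord ler1n.
have tot : \sum_(b : 'Z_q) B ^+ 2 * (kap x' y' + P1 x' y' * c1 b + P2 x' y' * c2 b)
    = B ^+ 2 * kap x' y' * q%:R.
  rewrite -mulr_sumr !big_split -!mulr_sumr /= c1_sum c2_sum !mulr0 !addr0.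
  by rewrite sumr_const card_spin -mulrA mulr_natr.
apply/bigmax_leP; split => [|a _]; first by rewrite mulr_ge0.
rewrite root_marginal_level // BE.
under eq_bigr do rewrite BE exprMn square_expansion.
rewrite tot exprMn square_expansion.
rewrite (_ : _ - _ = (P1 x' y' * c1 a + P2 x' y' * c2 a) / (kap x' y' * q%:R)); last first.
  by field; rewrite !gt_eqF //; lra.
apply: ratio_le; last by rewrite -[X in X <= _]mulr1; apply: ler_pM.
apply: (le_trans (ler_normD _ _)); rewrite !normrM.
have b1 : `|P1 x' y'| * `|c1 a| <= t * (2 + 3 * t) * 2 by apply: ler_pM.
have b2 : `|P2 x' y'| * `|c2 a| <= t * (2 + 3 * t) * 2 by apply: ler_pM.
have : t * (2 + 3 * t) <= t * 5 by rewrite ler_wpM2l //; lra.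
by lra.
Qed.

Lemma not_robust : ~ robust_phase_transition (pair_potential M).
Proof.
(* With this [s] the contraction rate is [l * (3 - 2 * l)], which differs from [1] by
   [(1 - 2 * l) * (1 - l) > 0]. *)
have l0 := l_ge0; have l21 := l_lt; pose s : R := (1 - 2 * l) / 3.
have s0 : 0 < s by rewrite /s; lra.
have s1 : s <= 1 by rewrite /s; lra.
have rho1 : l * (2 + 3 * s) < 1.
  have : 0 < (1 - 2 * l) * (1 - l) by rewrite mulr_gt0; lra.
  have -> : l * (2 + 3 * s) = 1 - (1 - 2 * l) * (1 - l) by rewrite /s; field.
  by lra.
have rho0 : 0 <= l * (2 + 3 * s) by rewrite mulr_ge0 //; lra.
(* The tolerance [s / 2] makes the constant coefficient [A] at least [1/2], so that dividing by it
   leaves the others within [s]. *)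
have [u u01 hu] := expR_small_perturbation R _ (fun a : 'Z_q => - pair_potential M a 0)
  (s / 2) (divr_gt0 s0 (ltr0Sn _ _)).
have [a|a|A [X [Y [VE As Xs Ys]]]] :=
  even_expansion (fun a => expR (- (u * pair_potential M a 0))) (s / 2).
- by rewrite /pair_potential M_even.
- by have := hu a; rewrite mulrN.
have A12 : 1 / 2 <= A by move: As; rewrite ler_norml; lra.
have A0 : 0 < A by lra.
have XA Z : `|Z| <= s / 2 -> `|Z / A| <= s.
  move=> Zs; rewrite normrM normfV (gtr0_norm A0) ler_pdivrMr //.
  by apply: (le_trans Zs); rewrite ler_pM2l //; lra.
have VE' a : expR (- (u * pair_potential M a 0)) =
    A * (1 + X / A * c1 a + Y / A * c2 a).
  by rewrite VE; field; rewrite gt_eqF.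
move=> /(_ u u01) /eqP; apply.
set E := (X in inf X).
have E0 : lbound E 0.
  by move=> _ [C _ <-]; apply: (big_ind (fun z : R => 0 <= z)) => // z1 z2 h1 h2;
    rewrite le_max h1.
have En n : E (dist_to_uniform (root_marginal u (pair_potential M) (level n.+1))).
  exists (level n.+1) => //; split; [exact: cutset_level|by rewrite in_level].
apply/le_anti/andP; split; last by apply: lb_le_inf => //; exists (dist_to_uniform
   (root_marginal u (pair_potential M) (level 1))).
have cv : (fun n => 20 * ((l * (2 + 3 * s)) ^+ n * s)) @ \oo --> (0 : R).
  rewrite -[X in _ --> X](mulr0 20); apply: cvgMr.
  rewrite -[X in _ --> X](mul0r s); apply: cvgMl.
  by apply: cvg_expr; rewrite ger0_norm.
rewrite -(cvg_lim _ cv) //; apply: limr_ge; first by apply/cvg_ex; exists 0.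
near=> n; apply: (@le_trans _ _ (dist_to_uniform
   (root_marginal u (pair_potential M) (level n.+1)))).
  by apply: ge_inf => //; exists 0.
by apply: level_dist_to_uniform A0 VE' _ _ _ _ => //; [exact: XA|exact: XA|exact: ltW].
Unshelve. all: by end_near.
Qed.

End NoRobust.

(** * Fixed points in Fourier coordinates *)

Section FourierFixedPoint.
Variables (R : realType) (q : nat) (M : spin_matrix R q).
Variables (c1 c2 : 'Z_q -> R) (l1 l2 : R) (kap P1 P2 : R -> R -> R).
Hypothesis M_gt0 : forall i j, 0 < M i j.
Hypothesis M_sum : forall a : 'Z_q, \sum_b M a b = 1.
Hypothesis Mc1 : forall a : 'Z_q, \sum_b M a b * c1 b = l1 * c1 a.
Hypothesis Mc2 : forall a : 'Z_q, \sum_b M a b * c2 b = l2 * c2 a.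
Hypothesis c1_sum : \sum_a c1 a = 0.
Hypothesis c2_sum : \sum_a c2 a = 0.
Hypothesis square_expansion : forall x y a,
  (1 + x * c1 a + y * c2 a) ^+ 2 = kap x y + P1 x y * c1 a + P2 x y * c2 a.
Hypothesis kap_ge1 : forall x y, 1 <= kap x y.

(** Positivity of [f] needs no separate bound on [x] and [y]: [kap * g] is [M] applied to squares,
    and a zero of it would force [g = 0] everywhere, against its mean [1]. By the same mean a
    constant [g] would be [1], which its value at [0] excludes. *)
Lemma fourier_phase_transition x y :
  l1 * P1 x y = kap x y * x -> l2 * P2 x y = kap x y * y ->
  0 < x * c1 0 + y * c2 0 -> phase_transition (pair_potential M).
Proof.
move=> E1 E2 xy0; pose g a := 1 + x * c1 a + y * c2 a; pose f a := g a ^+ 2.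
have k1 := kap_ge1 x y; have k0 : 0 < kap x y by lra.
have MfE a : \sum_b M a b * f b = kap x y * g a.
  transitivity (kap x y * \sum_b M a b +
      P1 x y * \sum_b M a b * c1 b + P2 x y * \sum_b M a b * c2 b).
    rewrite !mulr_sumr -!big_split /=; apply: eq_bigr => b _.
    by rewrite /f /g square_expansion; ring.
  by rewrite M_sum Mc1 Mc2 !mulrA ![P1 _ _ * _]mulrC ![P2 _ _ * _]mulrC E1 E2 /g; ring.
have g_sum : \sum_a g a = #|'Z_q|%:R.
  by rewrite !big_split -!mulr_sumr /= c1_sum c2_sum !mulr0 !addr0 sumr_const.
have g0 a : 0 < g a.
  rewrite -(pmulr_rgt0 _ k0) -MfE lt0r sumr_ge0 ?andbT => [|b _]; last first.
    by rewrite mulr_ge0 ?sqr_ge0 // ltW.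
  apply/negP => /eqP /psumr_eq0P h.
  have gz b : g b = 0.
    have /eqP : M a b * f b = 0.
      by apply: h => // b' _; rewrite mulr_ge0 ?sqr_ge0 // ltW.
    by rewrite mulf_eq0 gt_eqF //= sqrf_eq0 => /eqP.
  move: g_sum; rewrite big1 // => /eqP; rewrite eq_sym pnatr_eq0.
  by rewrite card_ord.
have f0 a : 0 < f a by rewrite exprn_gt0.
have [b gb] : exists b, g 0 != g b.
  apply: contrapT => /forallNP h.
  have gE b : g b = g 0 by apply/eqP; rewrite eq_sym; exact: contra_notT (h b).
  have : g 0 * #|'Z_q|%:R = #|'Z_q|%:R.
    by rewrite -[RHS]g_sum (eq_bigr (fun=> g 0)) // sumr_const mulr_natr.
  move=> /(canRL (mulfK _)); rewrite divff ?card_ord ?pnatr_eq0 // => /(_ isT).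
  by rewrite /g; lra.
apply: (@fixed_point_phase_transition R q M f (kap x y ^+ 2) 0 b) => //.
  by move=> a; rewrite MfE exprMn.
by rewrite /f eqrXn2 // ltW.
Qed.

End FourierFixedPoint.

(** * Circulant transfer matrices *)

Definition box (R : realType) (a b r : R) : set (R * R) :=
  [set p | `|p.1 - a| < r /\ `|p.2 - b| < r].

Lemma open_box (R : realType) (a b r : R) : open (box R a b r).
Proof.
apply: openI.
  apply: (@open_comp _ _ (fun p : R * R => `|p.1 - a|) [set x | x < r]); last exact: open_lt.
  move=> p _; apply: cvg_norm; apply: cvgB; [exact: cvg_fst|exact: cvg_cst].
apply: (@open_comp _ _ (fun p : R * R => `|p.2 - b|) [set x | x < r]); last exact: open_lt.
move=> p _; apply: cvg_norm; apply: cvgB; [exact: cvg_snd|exact: cvg_cst].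
Qed.

Lemma connected_box (R : realType) (a b r : R) : connected (box R a b r).
Proof.
have [r0|r0] := leP r 0.
  rewrite (_ : box R a b r = set0); first exact: connected0.
  apply/seteqP; split => // p [h _]; have := le_lt_trans (normr_ge0 _) h; lra.
pose seg (p : R * R) (t : R) := (a + t * (p.1 - a), b + t * (p.2 - b)).
(* The box is a union of segments issued from its centre. *)
rewrite (_ : box R a b r = \bigcup_(p in box R a b r) (seg p @` `[0, 1])).
  apply: bigcup_connected.
    exists (a, b) => p _; exists 0; rewrite /= ?in_itv /= ?lexx ?ler01 //.
    by rewrite /seg !mul0r !addr0.
  move=> p _; apply: connected_continuous_connected.
    exact/connected_intervalP/interval_is_interval.
  apply: continuous_subspaceT => t.
  have h (z w : R) : (fun t : R => z + t * w) @ t --> z + t * w.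
    by apply: cvgD; [exact: cvg_cst|apply: cvgMl; exact: cvg_id].
  exact: cvg_pair (h _ _) (h _ _).
apply/seteqP; split => [p hp|_ [p [p1 p2] [t + <-]]].
  exists p => //; exists 1; rewrite /= ?in_itv /= ?lexx ?ler01 //.
  by rewrite /seg !mul1r !(addrC _ (_ - _)) !subrK; case: p hp.
rewrite /= in_itv /= => /andP[t0 t1]; rewrite /box /seg /=.
split; rewrite addrC addKr normrM (ger0_norm t0).
  by apply: le_lt_trans p1; rewrite ler_piMl.
by apply: le_lt_trans p2; rewrite ler_piMl.
Qed.

Section Circulant.
Variables (R : realType) (q : nat).
Hypothesis q1 : (1 < q)%N.

Definition angle (n : nat) : R := 2 * pi * n%:R / q%:R.

Lemma angleD m n : angle (m + n) = angle m + angle n.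
Proof. by rewrite /angle natrD mulrDr mulrDl. Qed.

Lemma angle_period : angle q = pi *+ 2.
Proof. by rewrite /angle mulfK ?pnatr_eq0 ?mulr_natl //; lia. Qed.

Lemma cos_angleDq n : cos (angle (n + q)) = cos (angle n).
Proof. by rewrite angleD angle_period cosD2pi. Qed.

Lemma sin_angleDq n : sin (angle (n + q)) = sin (angle n).
Proof. by rewrite angleD angle_period sinD2pi. Qed.

Lemma angleB n : (n <= q)%N -> angle (q - n) = - angle n + pi *+ 2.
Proof. by move=> nq; rewrite -angle_period -{2}(subnK nq) angleD; lra. Qed.

Lemma cos_angleB n : (n <= q)%N -> cos (angle (q - n)) = cos (angle n).
Proof. by move=> nq; rewrite angleB // cosD2pi cosN. Qed.

Lemma sin_angleB n : (n <= q)%N -> sin (angle (q - n)) = - sin (angle n).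
Proof. by move=> nq; rewrite angleB // sinD2pi sinN. Qed.

Lemma val_Zp_sub (k l : 'Z_q) :
  val (l - k) = if (k <= l)%N then (l - k)%N else (l + q - k)%N.
Proof.
have E : (Zp_trunc q).+2 = q by exact: Zp_cast.
have kq : (k < q)%N by rewrite -[X in (_ < X)%N]E.
have lq : (l < q)%N by rewrite -[X in (_ < X)%N]E.
rewrite /=; move: (nat_of_ord k) (nat_of_ord l) kq lq => {}k {}l kq lq.
rewrite !E; case: leqP => kl.
  have [->|k0] := eqVneq k 0%N; first by rewrite subn0 modnn addn0 modn_small ?subn0.
  rewrite (modn_small (m := (q - k)%N)); last by lia.
  by rewrite (_ : l + (q - k) = (l - k) + q)%N ?modnDr ?modn_small; lia.
by rewrite (modn_small (m := (q - k)%N)) ?modn_small; lia.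
Qed.

(** Reduction of [l - k] modulo [q] changes the angle by a full turn at most, which the cosine does
    not see. *)
Lemma spin_dist_angle (k l : 'Z_q) : spin_dist R k l = 1 - cos (angle (val (l - k))).
Proof.
have q0 : (q%:R : R) != 0 by rewrite pnatr_eq0; lia.
have kq : (k < q)%N by rewrite -[X in (_ < X)%N](Zp_cast q1).
rewrite val_Zp_sub /spin_dist; congr (1 - _); case: leqP => kl.
  by rewrite -cosN /angle natrB //; congr cos; field.
rewrite -cosN -cosD2pi -angle_period /angle natrB; last by lia.
by rewrite natrD; congr cos; field.
Qed.

Lemma circulant_clock (m : 'Z_q -> R) :
  (forall a, 0 < m a) -> \sum_a m a = 1 ->
  (forall a b : 'Z_q, cos (angle a) <= cos (angle b) -> m a <= m b) ->
  clock_transfer_matrix (\matrix_(k, l) m (l - k) : spin_matrix R q).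
Proof.
move=> m0 m1 mono.
have mono' (i j k l : 'Z_q) : spin_dist R i j >= spin_dist R k l -> m (j - i) <= m (l - k).
  by rewrite !spin_dist_angle => h; apply: mono; lra.
split.
- split=> [k l|k]; first by rewrite mxE ltW.
  rewrite -m1 (reindex_inj (addIr k)); apply: eq_bigr => l _.
  by rewrite mxE addrK.
- by move=> k l; rewrite mxE.
- by move=> k l g; rewrite !mxE opprD addrACA subrr addr0.
- move=> j k h; rewrite !mxE; apply/le_anti.
  by rewrite !mono' // h.
- by move=> i j k l; rewrite !mxE; exact: mono'.
Qed.

Lemma circulant_eigenvalue (m : 'Z_q -> R) (l : R) j :
  \sum_a m a * cos (angle (j * a)) = l -> \sum_a m a * sin (angle (j * a)) = 0 ->
  transfer_eigenvalue (\matrix_(k, l) m (l - k) : spin_matrix R q) j = l%:C.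
Proof.
move=> El E0; rewrite /transfer_eigenvalue.
transitivity (\sum_a ((m a * cos (angle (j * a)))%:C -
                      (m a * sin (angle (j * a)))%:C * 'i)).
  apply: eq_bigr => a _; rewrite mxE subr0 /expNi /angle natrM mulrA.
  by apply/eqP; rewrite eq_complex /=; apply/andP; split; apply/eqP; ring.
rewrite big_split /= sumrN -mulr_suml -!rmorph_sum El E0 rmorph0.
by rewrite mul0r subr0.
Qed.

End Circulant.

(** * Four states *)

(** Computes the values of closed spins, such as differences [l - k], so that the tables read by
    [nth] reduce. *)
Ltac eval_ord := repeat match goal with |- context [nat_of_ord ?x] =>
  let v := eval vm_compute in (nat_of_ord x) in progress change (nat_of_ord x) with v end.

Section FourState.
Variables (R : realType) (l1 l2 : R).
Local Notation spin := 'Z_4.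

Lemma sum_Z4 (F : spin -> R) : \sum_a F a = F 0 + F 1 + F 2 + F 3.
Proof.
rewrite !big_ord_recl big_ord0 addr0 !addrA; congr (_ + F _ + F _ + F _); exact/val_inj.
Qed.

Lemma all_Z4 (P : spin -> Prop) : P 0 -> P 1 -> P 2 -> P 3 -> forall a, P a.
Proof.
move=> h0 h1 h2 h3 [[|[|[|[|//]]]] i]; [move: h0|move: h1|move: h2|move: h3];
  by congr P; exact/val_inj.
Qed.

(* The real parts of the characters of [Z_4], with no factor [2] for [c1]. *)
Definition four_c1 (a : spin) : R := nth 0 [:: 1; 0; -1; 0] a.
Definition four_c2 (a : spin) : R := nth 0 [:: 1; -1; 1; -1] a.
(** Inverse Fourier transform: [l1] belongs to the two characters of indices [1] and [3], whence its
    factor [2], and [l2] to a single one. *)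
Definition four_row (a : spin) : R := (1 + 2 * l1 * four_c1 a + l2 * four_c2 a) / 4.
Definition four_matrix : spin_matrix R 4 := \matrix_(k, l) four_row (l - k).

Let angle1 : angle R 4 1 = pi / 2.
Proof. by rewrite /angle; field. Qed.

Let cos4 n : (n < 4)%N -> cos (angle R 4 n) = nth 0 [:: 1; 0; -1; 0] n.
Proof.
case: n => [|[|[|[|//]]]] _ /=.
- by rewrite /angle mulr0 mul0r cos0.
- by rewrite angle1 cos_pihalf.
- by rewrite -cospi /angle; congr cos; field.
- by rewrite -[3%N]/(4 - 1)%N cos_angleB // angle1 cos_pihalf.
Qed.

Let sin4 n : (n < 4)%N -> sin (angle R 4 n) = nth 0 [:: 0; 1; 0; -1] n.
Proof.
case: n => [|[|[|[|//]]]] _ /=.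
- by rewrite /angle mulr0 mul0r sin0.
- by rewrite angle1 sin_pihalf.
- by rewrite -sinpi /angle; congr sin; field.
- by rewrite -[3%N]/(4 - 1)%N sin_angleB // angle1 sin_pihalf.
Qed.

Hypotheses (l1_ge : 22/45 <= l1) (l1_le : l1 <= 28/57).
Hypotheses (l2_ge : 22/49 <= l2) (l2_le : l2 <= 37/82).

Let row_gt0 a : 0 < four_row a.
Proof.
have := l1_ge; have := l1_le; have := l2_ge; have := l2_le.
elim/all_Z4: a; rewrite /four_row /four_c1 /four_c2 /=; lra.
Qed.

Let row_sum : \sum_a four_row a = 1.
Proof. by rewrite sum_Z4 /four_row /four_c1 /four_c2 /=; field. Qed.

Let matrix_gt0 i j : 0 < four_matrix i j. Proof. by rewrite mxE. Qed.

Lemma four_clock : clock_transfer_matrix four_matrix.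
Proof.
apply: circulant_clock => // a b.
have := l1_ge; have := l1_le; have := l2_ge; have := l2_le.
elim/all_Z4: a; elim/all_Z4: b; rewrite !cos4 // /four_row /four_c1 /four_c2 /=; lra.
Qed.

Lemma four_eigenvalue1 : transfer_eigenvalue four_matrix 1 = l1%:C.
Proof.
apply: circulant_eigenvalue; rewrite sum_Z4 /four_row /four_c1 /four_c2; eval_ord => /=.
  by rewrite !mul1n !cos4 //=; field.
by rewrite !mul1n !sin4 //=; field.
Qed.

Lemma four_eigenvalue2 : transfer_eigenvalue four_matrix 2 = l2%:C.
Proof.
apply: circulant_eigenvalue; rewrite sum_Z4 /four_row /four_c1 /four_c2; eval_ord => /=.
  rewrite muln0 muln1 -[(2 * 2)%N]/(0 + 4)%N -[(2 * 3)%N]/(2 + 4)%N.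
  by rewrite !cos_angleDq // !cos4 //=; field.
rewrite muln0 muln1 -[(2 * 2)%N]/(0 + 4)%N -[(2 * 3)%N]/(2 + 4)%N.
by rewrite !sin_angleDq // !sin4 //=; field.
Qed.

Let Mc1 a : \sum_b four_matrix a b * four_c1 b = l1 * four_c1 a.
Proof.
elim/all_Z4: a; rewrite sum_Z4 !mxE /four_row /four_c1 /four_c2; eval_ord => /=; by field.
Qed.

Let Mc2 a : \sum_b four_matrix a b * four_c2 b = l2 * four_c2 a.
Proof.
elim/all_Z4: a; rewrite sum_Z4 !mxE /four_row /four_c1 /four_c2; eval_ord => /=; by field.
Qed.

Let Msum a : \sum_b four_matrix a b = 1.
Proof.
elim/all_Z4: a; rewrite sum_Z4 !mxE /four_row /four_c1 /four_c2; eval_ord => /=; by field.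
Qed.

Let c1_sum : \sum_a four_c1 a = 0.
Proof. by rewrite sum_Z4 /four_c1 /=; field. Qed.

Let c2_sum : \sum_a four_c2 a = 0.
Proof. by rewrite sum_Z4 /four_c2 /=; field. Qed.

(** From [c1^2 = (1 + c2) / 2], [c2^2 = 1] and [c1 * c2 = c1]. *)
Let kap (x y : R) := 1 + x ^+ 2 / 2 + y ^+ 2.
Let P1 (x y : R) := 2 * x + 2 * x * y.
Let P2 (x y : R) := 2 * y + x ^+ 2 / 2.

Let square_expansion x y a : (1 + x * four_c1 a + y * four_c2 a) ^+ 2 =
  kap x y + P1 x y * four_c1 a + P2 x y * four_c2 a.
Proof. by elim/all_Z4: a; rewrite /kap /P1 /P2 /four_c1 /four_c2 /=; field. Qed.

Let kap_ge1 x y : 1 <= kap x y.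
Proof. by rewrite /kap; have := sqr_ge0 x; have := sqr_ge0 y; lra. Qed.

Lemma four_phase_transition : phase_transition (pair_potential four_matrix).
Proof.
have := l1_ge; have := l1_le; have := l2_ge; have := l2_le => h1 h2 h3 h4.
(* Dividing the first equation by [x] gives [x^2] in terms of [y]; substituted into the second, it
   leaves this quadratic. It is positive at [0], negative at [1/10] and positive at [4/10]: the
   larger root is taken. *)
pose p : {poly R} := (2 * l1 + l2) *: 'X^2 +
  (2 * l1 - 2 * l1 * l2 - 2 * l2) *: 'X + (l2 * (1 - 2 * l1))%:P.
have pE y : p.[y] = (2 * l1 + l2) * y ^+ 2 +
    (2 * l1 - 2 * l1 * l2 - 2 * l2) * y + l2 * (1 - 2 * l1).
  by rewrite /p !hornerE.
have [||y /andP[y1 y2] /rootP] := @poly_ivt R p (1/10) (4/10); first by lra.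
  by rewrite !pE; apply/andP; split; nra.
rewrite pE => py.
have x2 : 0 < 2 * (2 * l1 - 1 + 2 * l1 * y - y ^+ 2) by nra.
pose x := Num.sqrt (2 * (2 * l1 - 1 + 2 * l1 * y - y ^+ 2)).
have x0 : 0 < x by rewrite sqrtr_gt0.
have xx : x ^+ 2 = 2 * (2 * l1 - 1 + 2 * l1 * y - y ^+ 2) by rewrite sqr_sqrtr // ltW.
apply: (fourier_phase_transition R 4 four_matrix four_c1 four_c2 l1 l2 kap P1 P2
  matrix_gt0 Msum Mc1 Mc2 c1_sum c2_sum square_expansion kap_ge1 x y).
- by rewrite /kap /P1 xx; field.
- by rewrite /kap /P2 xx; lra.
- by rewrite /four_c1 /four_c2 /=; lra.
Qed.

Lemma four_not_robust : ~ robust_phase_transition (pair_potential four_matrix).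
Proof.
have := l1_ge; have := l1_le; have := l2_ge; have := l2_le => h1 h2 h3 h4.
apply: (not_robust R 4 four_matrix four_c1 four_c2 l1 l2 (28/57) kap P1 P2
  (card_ord _) matrix_gt0 Msum _ Mc1 Mc2 c1_sum c2_sum _ _ square_expansion kap_ge1).
- by elim/all_Z4; rewrite !mxE /four_row /four_c1 /four_c2; eval_ord.
- by elim/all_Z4; rewrite /four_c1 /= ler_norml; lra.
- by elim/all_Z4; rewrite /four_c2 /= ler_norml; lra.
- move=> x y s; rewrite !ler_norml => /andP[x1 x2] /andP[y1 y2].
  rewrite /P1 /P2; split; apply/andP; split; nra.
- by rewrite ler_norml; lra.
- by rewrite ler_norml; lra.
- by lra.
- move=> v e ve ve1; have v31 : v 3 = v 1 by rewrite ve; congr v; exact/val_inj.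
  (* Fourier coefficients of an even [v]. In each the absolute values of the weights add up to [1],
     which gives the bound [e]. *)
  exists ((v 0 + 2 * v 1 + v 2) / 4), ((v 0 - v 2) / 2), ((v 0 - 2 * v 1 + v 2) / 4).
  have := ve1 0; have := ve1 1; have := ve1 2; rewrite !ler_norml.
  move=> /andP[? ?] /andP[? ?] /andP[? ?]; split; try (apply/andP; split; lra).
  by elim/all_Z4; rewrite ?v31 /four_c1 /four_c2 /=; field.
Qed.

End FourState.

(** * Five states *)

Section FiveState.
Variables (R : realType) (l1 l2 : R).
Local Notation spin := 'Z_5.

Lemma sum_Z5 (F : spin -> R) : \sum_a F a = F 0 + F 1 + F 2 + F 3 + F 4.
Proof.
rewrite !big_ord_recl big_ord0 addr0 !addrA.
by congr (_ + F _ + F _ + F _ + F _); exact/val_inj.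
Qed.

Lemma all_Z5 (P : spin -> Prop) : P 0 -> P 1 -> P 2 -> P 3 -> P 4 -> forall a, P a.
Proof.
move=> h0 h1 h2 h3 h4 [[|[|[|[|[|//]]]]] i];
  [move: h0|move: h1|move: h2|move: h3|move: h4]; by congr P; exact/val_inj.
Qed.

(** The inverse golden ratio; [-1 - al] below is [2 cos (4 pi / 5)]. *)
Definition golden : R := 2 * cos (angle R 5 1).
Local Notation al := golden.

Let th0 : 0 < angle R 5 1.
Proof. by rewrite /angle; have := @pi_gt0 R; lra. Qed.

Let angle_small : angle R 5 1 < pi / 2.
Proof. by rewrite /angle; have := @pi_gt0 R; lra. Qed.

Let cos2 : cos (angle R 5 2) = 2 * cos (angle R 5 1) ^+ 2 - 1.
Proof.
rewrite -[2%N]/(1 + 1)%N angleD cosD.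
by have := cos2Dsin2 (angle R 5 1); rewrite !expr2; lra.
Qed.

Let golden_gt0 : 0 < al.
Proof.
rewrite mulr_gt0 // cos_gt0_pihalf // angle_small andbT.
by have := th0; have := @pi_gt0 R; lra.
Qed.

(* With [theta = 2 pi / 5], from [cos (3 theta) = cos (2 theta)]. *)
Lemma golden_eq : al ^+ 2 = 1 - al.
Proof.
have h3 : cos (angle R 5 3) = cos (angle R 5 2) by rewrite -cos_angleB.
have s0 : 0 < sin (angle R 5 1).
  by apply: sin_gt0_pi; have := angle_small; have := th0; have := @pi_gt0 R; lra.
have := cos2Dsin2 (angle R 5 1).
move: h3; rewrite cos2 -[3%N]/(1 + (1 + 1))%N !angleD !cosD !sinD.
rewrite /al; move: (cos _) (sin _) s0 => c s s0 h3 cs.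
(* The relation between the cosines also holds at [theta = 0], which gives the spurious factor
   [c - 1]; the positive sine excludes it. *)
have c1 : c - 1 != 0 by apply/eqP => c1; nra.
have ccs : c * (c ^+ 2 + s ^+ 2) = c by rewrite cs mulr1.
have : (c - 1) * (4 * c ^+ 2 + 2 * c - 1) = 0 by lra.
move/eqP; rewrite mulf_eq0 (negbTE c1) /= => /eqP; lra.
Qed.

Let golden_bounds : 1 / 2 < al < 1.
Proof. by have := golden_eq; have := golden_gt0; nra. Qed.

Definition five_c1 (a : spin) : R := nth 0 [:: 2; al; -1 - al; -1 - al; al] a.
Definition five_c2 (a : spin) : R := nth 0 [:: 2; -1 - al; al; al; -1 - al] a.
Definition five_row (a : spin) : R := (1 + l1 * five_c1 a + l2 * five_c2 a) / 5.
Definition five_matrix : spin_matrix R 5 := \matrix_(k, l) five_row (l - k).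

Let cos5 n : (n < 5)%N -> cos (angle R 5 n) =
  nth 0 [:: 1; al / 2; (-1 - al) / 2; (-1 - al) / 2; al / 2] n.
Proof.
have c1 : cos (angle R 5 1) = al / 2 by rewrite /al; field.
have c2 : cos (angle R 5 2) = (-1 - al) / 2.
  by rewrite cos2 c1; have := golden_eq; lra.
case: n => [|[|[|[|[|//]]]]] _ //=.
- by rewrite /angle mulr0 mul0r cos0.
- by rewrite -[3%N]/(5 - 2)%N cos_angleB.
- by rewrite -[4%N]/(5 - 1)%N cos_angleB.
Qed.

Let sin5 : exists s t, forall n, (n < 5)%N ->
  sin (angle R 5 n) = nth 0 [:: 0; s; t; - t; - s] n.
Proof.
exists (sin (angle R 5 1)), (sin (angle R 5 2)).
case=> [|[|[|[|[|//]]]]] _ //=.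
- by rewrite /angle mulr0 mul0r sin0.
- by rewrite -[3%N]/(5 - 2)%N sin_angleB.
- by rewrite -[4%N]/(5 - 1)%N sin_angleB.
Qed.

Hypotheses (l1_ge : 22/45 <= l1) (l1_le : l1 <= 28/57).
Hypotheses (l2_ge : 22/49 <= l2) (l2_le : l2 <= 37/82).

(** These products are atoms for [lra], so the golden equation and the bounds on [al] are supplied
    already multiplied by the eigenvalues. *)
Let golden_mul : [/\ l1 * al ^+ 2 = l1 * (1 - al), l2 * al ^+ 2 = l2 * (1 - al),
  l1 / 2 < l1 * al < l1, l2 / 2 < l2 * al < l2 & 0 < l1 * al - l2 * al < l1 - l2].
Proof.
have := l1_ge; have := l2_le; have := l2_ge; have /andP[a0 a1] := golden_bounds.
move=> h2 h3 h4; rewrite golden_eq; split=> //; apply/andP; split; nra.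
Qed.

Let row_order : [/\ 0 < five_row 2, five_row 2 <= five_row 1 & five_row 1 <= five_row 0].
Proof.
have := l1_ge; have := l1_le; have := l2_ge; have := l2_le => h1 h2 h3 h4.
have [_ _ /andP[? ?] /andP[? ?] /andP[? ?]] := golden_mul.
by rewrite /five_row /five_c1 /five_c2 /=; split; lra.
Qed.

Let row_gt0 a : 0 < five_row a.
Proof.
have [r2 r1 r0] := row_order.
have r1' := lt_le_trans r2 r1; have r0' := lt_le_trans r1' r0.
by elim/all_Z5: a.
Qed.

Let row_sum : \sum_a five_row a = 1.
Proof. by rewrite sum_Z5 /five_row /five_c1 /five_c2 /=; field. Qed.

Let matrix_gt0 i j : 0 < five_matrix i j. Proof. by rewrite mxE. Qed.

Lemma five_clock : clock_transfer_matrix five_matrix.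
Proof.
apply: circulant_clock => // a b; have [_ r1 r0] := row_order.
have r2 := le_trans r1 r0; have /andP[a0 a1] := golden_bounds.
have [g1 g2] : al / 2 < 1 /\ (-1 - al) / 2 < al / 2 by lra.
have g3 := lt_trans g2 g1.
by elim/all_Z5: a; elim/all_Z5: b; rewrite !cos5 //= => h; rewrite // leNgt in h *;
  rewrite ?g1 ?g2 ?g3 in h.
Qed.

Lemma five_eigenvalue1 : transfer_eigenvalue five_matrix 1 = l1%:C.
Proof.
have [E1 E2 _ _ _] := golden_mul; have [s [t st]] := sin5.
apply: circulant_eigenvalue; rewrite sum_Z5 /five_row /five_c1 /five_c2; eval_ord => /=.
  by rewrite !mul1n !cos5 //=; lra.
by rewrite !mul1n !st //=; field.
Qed.

Lemma five_eigenvalue2 : transfer_eigenvalue five_matrix 2 = l2%:C.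
Proof.
have [E1 E2 _ _ _] := golden_mul; have [s [t st]] := sin5.
apply: circulant_eigenvalue; rewrite sum_Z5 /five_row /five_c1 /five_c2; eval_ord => /=;
  rewrite muln0 muln1 -[(2 * 2)%N]/4%N -[(2 * 3)%N]/(1 + 5)%N -[(2 * 4)%N]/(3 + 5)%N.
  by rewrite !cos_angleDq // !cos5 //=; lra.
by rewrite !sin_angleDq // !st //=; field.
Qed.

Let Mc1 a : \sum_b five_matrix a b * five_c1 b = l1 * five_c1 a.
Proof.
have [E1 E2 _ _ _] := golden_mul; have := golden_eq => E0.
elim/all_Z5: a; rewrite sum_Z5 !mxE /five_row /five_c1 /five_c2; eval_ord => /=; lra.
Qed.

Let Mc2 a : \sum_b five_matrix a b * five_c2 b = l2 * five_c2 a.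
Proof.
have [E1 E2 _ _ _] := golden_mul; have := golden_eq => E0.
elim/all_Z5: a; rewrite sum_Z5 !mxE /five_row /five_c1 /five_c2; eval_ord => /=; lra.
Qed.

Let Msum a : \sum_b five_matrix a b = 1.
Proof.
by elim/all_Z5: a; rewrite sum_Z5 !mxE /five_row /five_c1 /five_c2; eval_ord => /=; field.
Qed.

Let c1_sum : \sum_a five_c1 a = 0.
Proof. by rewrite sum_Z5 /five_c1 /=; field. Qed.

Let c2_sum : \sum_a five_c2 a = 0.
Proof. by rewrite sum_Z5 /five_c2 /=; field. Qed.

(** From [c1^2 = 2 + c2], [c2^2 = 2 + c1] and [c1 * c2 = c1 + c2]. *)
Let kap (x y : R) := 1 + 2 * x ^+ 2 + 2 * y ^+ 2.
Let P1 (x y : R) := 2 * x + y ^+ 2 + 2 * x * y.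
Let P2 (x y : R) := 2 * y + x ^+ 2 + 2 * x * y.

Let square_expansion x y a : (1 + x * five_c1 a + y * five_c2 a) ^+ 2 =
  kap x y + P1 x y * five_c1 a + P2 x y * five_c2 a.
Proof.
have E0 := golden_eq.
have Ex : x ^+ 2 * al ^+ 2 = x ^+ 2 * (1 - al) by rewrite E0.
have Ey : y ^+ 2 * al ^+ 2 = y ^+ 2 * (1 - al) by rewrite E0.
have Exy : x * y * al ^+ 2 = x * y * (1 - al) by rewrite E0.
by elim/all_Z5: a; rewrite /kap /P1 /P2 /five_c1 /five_c2 /=; lra.
Qed.

Let kap_ge1 x y : 1 <= kap x y.
Proof. by rewrite /kap; have := sqr_ge0 x; have := sqr_ge0 y; lra. Qed.

Lemma five_phase_transition : phase_transition (pair_potential five_matrix).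
Proof.
have := l1_ge; have := l1_le; have := l2_ge; have := l2_le => h1 h2 h3 h4.
(* With [y = t x], eliminating [kap] from the two equations gives [x = N t / D t],
   and substituting this into the first one gives [G t = 0]. *)
pose N t := 2 * t * (l1 - l2).
pose D t := l2 * (1 + 2 * t) - l1 * t ^+ 2 * (t + 2).
pose G t := D t ^+ 2 * (1 - 2 * l1) + 2 * N t ^+ 2 * (1 + t ^+ 2)
  - l1 * (N t * D t) * (t * (t + 2)).
have [t /andP[t1 t2] Gt] : exists2 t, 7/10 <= t <= 9/10 & G t = 0.
  pose pN : {poly R} := (2 * (l1 - l2)) *: 'X.
  pose pD : {poly R} := l2 *: (1 + 2 *: 'X) - l1 *: ('X^2 * ('X + 2%:P)).
  pose p : {poly R} := (1 - 2 * l1) *: pD ^+ 2 + 2 *: (pN ^+ 2 * (1 + 'X^2))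
    - l1 *: (pN * pD * ('X * ('X + 2%:P))).
  have pE t : p.[t] = G t.
    rewrite /p /pN /pD !(hornerD, hornerN, hornerZ, hornerM, horner_exp, hornerX,
      hornerC) /G /N /D; ring.
  have [||t ht /rootP] := @poly_ivt R p (7/10) (9/10); first by lra.
    rewrite !pE /G; apply/andP; split.
      have : 1/20 <= N (7/10) <= 3/50 by rewrite /N; apply/andP; split; lra.
      have : 21/50 <= D (7/10) <= 11/25 by rewrite /D; apply/andP; split; lra.
      move: (N _) (D _) => n d /andP[d1 d2] /andP[n1 n2].
      have nd : 1/20 * (21/50) <= n * d by apply: ler_pM; lra.
      have lnd : 12/25 * (1/20 * (21/50)) <= l1 * (n * d).
        by apply: ler_pM; lra.
      have nn : n ^+ 2 <= (3/50) ^+ 2 by rewrite lerXn2r ?nnegrE; lra.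
      have dd : d ^+ 2 <= (11/25) ^+ 2 by rewrite lerXn2r ?nnegrE; lra.
      have : d ^+ 2 * (1 - 2 * l1) <= (11/25) ^+ 2 * (1/40).
        by apply: ler_pM; [exact: sqr_ge0|lra|exact: dd|lra].
      by lra.
    have : 1/15 <= N (9/10) <= 1/13 by rewrite /N; apply/andP; split; lra.
    have : 1/10 <= D (9/10) <= 3/25 by rewrite /D; apply/andP; split; lra.
    move: (N _) (D _) => n d /andP[d1 d2] /andP[n1 n2].
    have nd : n * d <= 1/13 * (3/25) by apply: ler_pM; lra.
    have lnd : l1 * (n * d) <= 1/2 * (1/13 * (3/25)).
      by apply: ler_pM; [lra|apply: mulr_ge0; lra|lra|exact: nd].
    have nn : (1/15) ^+ 2 <= n ^+ 2 by rewrite lerXn2r ?nnegrE; lra.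
    have : 0 <= d ^+ 2 * (1 - 2 * l1) by rewrite mulr_ge0 ?sqr_ge0; lra.
    by lra.
  by rewrite pE => Gt; exists t.
have N0 : 0 < N t by rewrite /N mulr_gt0; lra.
have t0 : 0 < t by lra.
have tt : 0 < t * (t + 2) by rewrite mulr_gt0; lra.
(* If [D t <= 0], no term of [G t] is negative and the one in [N^2] is positive, so [G t] could not
   vanish. *)
have D0 : 0 < D t.
  rewrite ltNge; apply/negP => D0; move: Gt; rewrite /G.
  have : 0 <= D t ^+ 2 * (1 - 2 * l1) by rewrite mulr_ge0 ?sqr_ge0; lra.
  have : 0 < 2 * N t ^+ 2 * (1 + t ^+ 2).
    by rewrite !mulr_gt0 ?exprn_gt0 //; have := sqr_ge0 t; lra.
  have : 0 <= l1 * (N t * - D t) * (t * (t + 2)).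
    apply: mulr_ge0; last exact: ltW.
    by apply: mulr_ge0; [lra|apply: mulr_ge0; rewrite ?oppr_ge0 // ltW].
  by rewrite mulrN; lra.
pose r := N t / D t.
have r0 : 0 < r by rewrite divr_gt0.
have ND : N t = r * D t by rewrite /r mulfVK // gt_eqF.
have K : 1 + 2 * r ^+ 2 + 2 * (t * r) ^+ 2 = l1 * (2 + (t * (t + 2)) * r).
  apply: (mulfI (_ : D t ^+ 2 != 0)); first by rewrite expf_eq0 gt_eqF.
  by move: Gt; rewrite /G ND; lra.
have E2 : l2 * (2 * t + r + 2 * t * r) = t * (l1 * (2 + t * (t + 2) * r)).
  by move: ND; rewrite /N /D; lra.
apply: (fourier_phase_transition R 5 five_matrix five_c1 five_c2 l1 l2 kap P1 P2
  matrix_gt0 Msum Mc1 Mc2 c1_sum c2_sum square_expansion kap_ge1 r (t * r)).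
- by rewrite /kap /P1 K; ring.
- rewrite /kap /P2 K (_ : l1 * _ * (t * r) = t * (l1 * (2 + t * (t + 2) * r)) * r); last by ring.
  by rewrite -E2; ring.
- by rewrite /five_c1 /five_c2 /= -mulrDl mulr_gt0 // addr_gt0 // mulr_gt0.
Qed.

Lemma five_not_robust : ~ robust_phase_transition (pair_potential five_matrix).
Proof.
have := l1_ge; have := l1_le; have := l2_ge; have := l2_le => h1 h2 h3 h4.
have /andP[a1 a2] := golden_bounds.
apply: (not_robust R 5 five_matrix five_c1 five_c2 l1 l2 (28/57) kap P1 P2
  (card_ord _) matrix_gt0 Msum _ Mc1 Mc2 c1_sum c2_sum _ _ square_expansion kap_ge1).
- by elim/all_Z5; rewrite !mxE /five_row /five_c1 /five_c2; eval_ord.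
- by elim/all_Z5; rewrite /five_c1 /= ler_norml; lra.
- by elim/all_Z5; rewrite /five_c2 /= ler_norml; lra.
- move=> x y s xs ys; have s0 : 0 <= s by exact: le_trans (normr_ge0 _) xs.
  have x2 : x ^+ 2 <= s ^+ 2 by rewrite -real_normK ?num_real // lerXn2r ?nnegrE.
  have y2 : y ^+ 2 <= s ^+ 2 by rewrite -real_normK ?num_real // lerXn2r ?nnegrE.
  have : `|x * y| <= s ^+ 2 by rewrite normrM expr2 ler_pM.
  have := sqr_ge0 x; have := sqr_ge0 y.
  move: xs ys; rewrite !ler_norml => /andP[? ?] /andP[? ?] ? ? /andP[? ?].
  by rewrite /P1 /P2; split; apply/andP; split; lra.
- by rewrite ler_norml; lra.
- by rewrite ler_norml; lra.
- by lra.
- move=> v e ve ve1; have v41 : v 4 = v 1 by rewrite ve; congr v; exact/val_inj.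
  have v32 : v 3 = v 2 by rewrite ve; congr v; exact/val_inj.
  (* Again the Fourier coefficients; as [al < 1], the absolute weights add up to at most [1]. *)
  exists ((v 0 + 2 * v 1 + 2 * v 2) / 5),
    ((v 0 + al * v 1 + (-1 - al) * v 2) / 5), ((v 0 + (-1 - al) * v 1 + al * v 2) / 5).
  have E0 := golden_eq.
  have E (z : R) : z * al ^+ 2 = z * (1 - al) by rewrite E0.
  have B (z : R) : `|z| <= e -> - e <= al * z <= e.
    move=> ze; rewrite -ler_norml normrM (gtr0_norm golden_gt0).
    by apply: le_trans ze; rewrite ler_piMl ?normr_ge0 ?ltW.
  have /andP[? ?] := B _ (ve1 1); have /andP[? ?] := B _ (ve1 2).
  have := ve1 0; have := ve1 1; have := ve1 2; rewrite !ler_norml.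
  move=> /andP[? ?] /andP[? ?] /andP[? ?]; split; try (apply/andP; split; lra).
  have e1 := E (v 1); have e2 := E (v 2).
  by elim/all_Z5; rewrite ?v41 ?v32 /five_c1 /five_c2 /=; lra.
Qed.

End FiveState.

Theorem theorem2p6 (R : realType) (q : nat) (hq : (q = 4 \/ q = 5)%N) :
  exists D : set (R * R),
    [/\ D !=set0, open D, connected D
      & forall l1 l2 : R, D (l1, l2) ->
          exists M : spin_matrix R q,
            [/\ clock_transfer_matrix M,
                transfer_eigenvalue M 1 = l1%:C,
                transfer_eigenvalue M 2 = l2%:C,
                phase_transition (pair_potential M)
              & ~ robust_phase_transition (pair_potential M)]].
Proof.
exists (box R (49/100) (9/20) (1/1000)); split.
- by exists (49/100, 9/20); rewrite /box /= !subrr normr0; lra.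
- exact: open_box.
- exact: connected_box.
move=> l1 l2 [/= /ltW + /ltW]; rewrite !ler_norml => /andP[h1 h2] /andP[h3 h4].
(* Fractions with small denominators that enclose the box; the largest, [28/57], is still below
   [1/2]. *)
have [a1 a2 a3 a4] : [/\ 22/45 <= l1, l1 <= 28/57, 22/49 <= l2 & l2 <= 37/82].
  by split; lra.
case: hq => ->.
  exists (four_matrix R l1 l2); split; [exact: four_clock|exact: four_eigenvalue1|
    exact: four_eigenvalue2|exact: four_phase_transition|exact: four_not_robust].
exists (five_matrix R l1 l2); split; [exact: five_clock|exact: five_eigenvalue1|
  exact: five_eigenvalue2|exact: five_phase_transition|exact: five_not_robust].
Qed.
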